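(* Let $R$ be a ring. An $R$-module $M$ is PGF if and only if there exists an acyclic complex $\mathbf{G}=\cdots\to G_1\to G_0\to G^0\to G^1\to\cdots$ of PGF $R$-modules with $M\cong\mathrm{Im}(G_0\to G^0)$ such that $I\otimes_R\mathbf{G}$ is acyclic for every injective right $R$-module $I$. That is, $\mathtt{PGF}(R)=\mathtt{PGF}^{(2)}_{\mathcal{I}}(R)$.
   Context: Modules are left $R$-modules over an arbitrary ring $R$. A module is PGF (projectively coresolved Gorenstein flat) if it is a syzygy in an acyclic complex $\mathbf{P}$ of projective modules such that $I\otimes_R\mathbf{P}$ is acyclic for every injective right $R$-module $I$. $\mathtt{PGF}^{(2)}_{\mathcal{I}}(R)$ denotes the class of modules that are syzygies in an acyclic complex $\mathbf{G}$ of PGF modules such that $I\otimes_R\mathbf{G}$ is acyclic for every injective right $R$-module $I$. *)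

(* Defs.v *)
From HB Require Import structures.
From mathcomp Require Import all_boot all_order all_algebra.
Set Implicit Arguments. Unset Strict Implicit. Unset Printing Implicit Defensive.
Import GRing.Theory.
Local Open Scope ring_scope.

Definition exact_seq (T : int -> zmodType) (d : forall n, T n -> T (n + 1)%R) : Prop :=
  forall n : int,
    (forall y : T n, d (n + 1)%R (d n y) = 0) /\
    (forall x : T (n + 1)%R, d (n + 1)%R x = 0 -> exists y : T n, d n y = x).

(* A (cochain-indexed) complex of left R-modules; homological degrees
   ... G_1 -> G_0 -> G^0 -> G^1 ... are reindexed by int. *)
Record complex (R : pzRingType) := Complex {
  cobj : int -> lmodType R;
  cdif : forall n : int, {linear cobj n -> cobj (n + 1)%R}
}.

Definition acyclic (R : pzRingType) (C : complex R) : Prop :=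
  @exact_seq (fun n => cobj C n : zmodType) (fun n => cdif C n).

Definition is_syzygy (R : pzRingType) (M : lmodType R) (C : complex R) : Prop :=
  exists (n : int) (f : {linear M -> cobj C (n + 1)%R}),
    injective f /\
    (forall y : cobj C (n + 1)%R,
        (exists x : cobj C n, cdif C n x = y) <-> (exists m : M, f m = y)).

Definition projective_mod (R : pzRingType) (P : lmodType R) : Prop :=
  forall (A B : lmodType R) (g : {linear A -> B}) (h : {linear P -> B}),
    (forall y : B, exists x : A, g x = y) -> exists k : {linear P -> A}, forall p, g (k p) = h p.

(* Right R-modules are left modules over the converse ring R^c:
   r *: i  (in R^c)  stands for  i * r. *)
Definition injective_mod (R : pzRingType) (I : lmodType R^c) : Prop :=
  forall (A B : lmodType R^c) (i : {linear A -> B}) (h : {linear A -> I}),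
    injective i -> exists k : {linear B -> I}, forall a, k (i a) = h a.

Definition balanced (R : pzRingType) (I : lmodType R^c) (M : lmodType R)
    (T : zmodType) (b : I -> M -> T) : Prop :=
  (forall i i' m, b (i + i') m = b i m + b i' m) /\
  (forall i m m', b i (m + m') = b i m + b i m') /\
  (forall (r : R) i m, b ((r : R^c) *: i) m = b i (r *: m)).

Definition is_tensor (R : pzRingType) (I : lmodType R^c) (M : lmodType R)
    (T : zmodType) (b : I -> M -> T) : Prop :=
  balanced b /\
  forall (A : zmodType) (c : I -> M -> A), balanced c ->
    (exists g : {additive T -> A}, forall i m, g (b i m) = c i m) /\
    (forall g g' : {additive T -> A},
        (forall i m, g (b i m) = g' (b i m)) -> forall t, g t = g' t).

(* I (x)_R C is acyclic: for any choice of tensor products of the terms and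
   the (unique) induced maps I (x) d_n, the resulting sequence is exact. *)
Definition tensor_acyclic (R : pzRingType) (I : lmodType R^c) (C : complex R) : Prop :=
  forall (T : int -> zmodType) (b : forall n, I -> cobj C n -> T n)
         (delta : forall n, {additive T n -> T (n + 1)%R}),
    (forall n, is_tensor (b n)) ->
    (forall n i x, delta n (b n i x) = b (n + 1)%R i (cdif C n x)) ->
    @exact_seq T (fun n => delta n).

Definition I_syzygy_of (R : pzRingType) (X : lmodType R -> Prop) (M : lmodType R) : Prop :=
  exists C : complex R,
    (forall n, X (cobj C n)) /\ acyclic C /\
    (forall I : lmodType R^c, injective_mod I -> tensor_acyclic I C) /\
    is_syzygy M C.

Definition PGF (R : pzRingType) (M : lmodType R) : Prop :=
  I_syzygy_of (@projective_mod R) M.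

Definition PGF2_I (R : pzRingType) (M : lmodType R) : Prop :=
  I_syzygy_of (@PGF R) M.

(* Main.v *)
(* Let D be a divisible cogenerator of abelian groups and I^+ = Hom_Z(I, D).
   Exactness of I (x) C for injective I amounts to exactness of Hom(C, I^+), so
   PGF modules are the syzygies of acyclic complexes of projectives that stay
   exact under Hom(-, N) for the N = I^+. The stability argument for such
   classes needs closure under extensions, hence Ext^1(M, P) = 0 for M PGF and P
   projective.

   To see the latter, test the tensored complex on a product of copies of
   Hom_Z(R, D): for each finite S in C_(n+1) there is a finite S' in C_n such
   that every c : C_(n+1) -> R with c d = 0 on S' agrees on S with some c' d.
   Over a countable set of elements closed under S |-> S', this Mittag-Leffler
   condition solves c = c' d by successive corrections; Mayer-Vietoris for unions
   of closed sets and Zorn's lemma give the general case.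

   Finally, let M be a syzygy in a complex of PGF modules, 0 -> M -> G -> Z -> 0.
   Embed G in a projective P with PGF cokernel K; then P / M is an extension of K
   by Z, and pushing it out along the next step of the complex embeds it into an
   extension of PGF modules with cokernel again a syzygy. Iterate, and dually for
   the projective resolution. *)

From HB Require Import structures.
Require Import Defs.
From mathcomp Require Import all_boot all_order all_algebra.
From mathcomp Require Import boolp classical_sets functions.
Set Implicit Arguments. Unset Strict Implicit. Unset Printing Implicit Defensive.
Import Order.TTheory GRing.Theory Num.Theory.
Local Open Scope ring_scope.

(** * Submodules and quotients *)

(** The stability argument sees only a class [NN] of test modules and the vanishing of Ext^1(M, P),
    so it is done for arbitrary [NN]; injective right modules enter through the translation to
    Hom(-, I^+) and through the finite condition.

    The obstacle in proving Ext^1(M, P) = 0 is that the terms C_n need be neither free nor finitely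
    generated: a linear map on C_n cannot be prescribed on a subset or glued from pieces. Hence
    linear maps are replaced by arbitrary functions on the disjoint union of the C_n, and dual bases
    supply an idempotent that turns a function into a linear one. Functions can be cut and glued by
    case distinction, and the differential of a function at a point reads only finitely many values.
    Gluing over two sets requires control of their intersection; this is why the sets used are
    closed under one fixed choice S |-> S', a property inherited by intersections.

    The passage from R to a projective target keeps S': finitely many values in the target have
    finitely many nonzero coordinates. *)

Lemma linear_of (R : pzRingType) (A B : lmodType R) (f : A -> B) :
  linear f -> exists g : {linear A -> B}, forall x, g x = f x.
Proof.
move=> lf.
pose g : {linear A -> B} := HB.pack f (GRing.isLinear.Build R A B *:%R f lf).
by exists g.
Qed.

Lemma additive_of (A B : zmodType) (f : A -> B) :
  (forall x y, f (x - y) = f x - f y) ->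
  exists g : {additive A -> B}, forall x, g x = f x.
Proof.
move=> lf.
pose g : {additive A -> B} := HB.pack f (GRing.isZmodMorphism.Build A B f lf).
by exists g.
Qed.

Definition is_submod (R : pzRingType) (M : lmodType R) (U : M -> Prop) : Prop :=
  U 0 /\ forall a x y, U x -> U y -> U (a *: x + y).

Section Submodule.
Variables (R : pzRingType) (M : lmodType R) (U : M -> Prop) (hU : is_submod U).

Definition submod_pred of is_submod U : {pred M} := fun x => `[< U x >].

Fact submod_pred_closed : submod_closed (submod_pred hU).
Proof.
case: hU => U0 UD; split; first exact/asboolP.
by move=> a x y /asboolP Ux /asboolP Uy; apply/asboolP/UD.
Qed.

HB.instance Definition _ :=
  GRing.isSubmodClosed.Build R M (submod_pred hU) submod_pred_closed.

Definition submod := {x : M | x \in submod_pred hU}.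

HB.instance Definition _ := SubType.on submod.
HB.instance Definition _ := [Choice of submod by <:].
HB.instance Definition _ := [SubChoice_isSubLmodule of submod by <:].

Lemma submod_exists :
  exists (K : lmodType R) (k : {linear K -> M}),
    injective k /\ (forall m, U m <-> exists x, k x = m).
Proof.
exists submod, (val : {linear submod -> M}); split; first exact: val_inj.
move=> m; split=> [Um | [x <-]]; last exact/asboolP/(valP x).
by exists (Sub m (asboolT Um) : submod); apply: SubK.
Qed.

End Submodule.

Section Quotient.
Variables (R : pzRingType) (M : lmodType R) (U : M -> Prop) (hU : is_submod U).

Lemma submodB x y : U x -> U y -> U (x - y).
Proof. by case: hU => _ UD Ux Uy; rewrite addrC -scaleN1r; apply: UD. Qed.

Lemma submodZ a x : U x -> U (a *: x).
Proof. by case: hU => U0 UD Ux; rewrite -[_ *: _]addr0; apply: UD. Qed.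

Lemma submodN x : U x -> U (- x).
Proof. by move=> Ux; rewrite -sub0r; apply: submodB => //; case: hU. Qed.

Lemma submodD x y : U x -> U y -> U (x + y).
Proof. by move=> Ux Uy; rewrite -[y]opprK; apply/submodB/submodN. Qed.

(** One representative is chosen per coset, so that the quotient is a subtype of M, the fixed points
    of this map, and inherits its choice structure. *)
Definition quot_repr of is_submod U : M -> M :=
  fun m => xget 0 (fun x => U (x - m)).

Local Notation rep := (quot_repr hU).

Lemma quot_reprP m : U (rep m - m).
Proof.
rewrite /quot_repr; case: xgetP => [x _ //|/(_ m)].
by rewrite subrr; case: hU => U0 _ /(_ U0).
Qed.

Lemma quot_repr_eq m m' : U (m - m') -> rep m = rep m'.
Proof.
move=> Umm'; rewrite /quot_repr.
have E : (fun x => U (x - m)) = (fun x => U (x - m')).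
  apply/funext => x; apply/propext; split=> Ux.
    have -> : x - m' = (x - m) - (0 - (m - m')).
      by rewrite sub0r opprK addrA subrK.
    by apply: submodB => //; apply: submodB => //; case: hU.
  have -> : x - m = (x - m') - (m - m').
    by rewrite opprB addrA subrK.
  exact: submodB.
by rewrite E.
Qed.

Definition quot := {m : M | rep m == m}.

Lemma quot_reprK m : rep (rep m) == rep m.
Proof. exact/eqP/quot_repr_eq/quot_reprP. Qed.

Definition quot_pi m : quot := exist _ (rep m) (quot_reprK m).

HB.instance Definition _ := SubType.on quot.
HB.instance Definition _ := [Choice of quot by <:].

Lemma quot_piP m m' : quot_pi m = quot_pi m' <-> U (m - m').
Proof.
split=> [[e]|Um]; last by apply/val_inj/quot_repr_eq.
have -> : m - m' = (rep m' - m') - (rep m - m).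
  by rewrite e opprB [RHS]addrC addrA subrK.
by apply: submodB; apply: quot_reprP.
Qed.

Lemma quot_piK (x : quot) : quot_pi (val x) = x.
Proof. by apply/val_inj/eqP/(valP x). Qed.

Definition quot_add (x y : quot) := quot_pi (val x + val y).
Definition quot_opp (x : quot) := quot_pi (- val x).
Definition quot_scale a (x : quot) := quot_pi (a *: val x).

Lemma quot_piD m m' : quot_pi (m + m') = quot_add (quot_pi m) (quot_pi m').
Proof.
apply/quot_piP => /=; rewrite opprD addrACA.
by apply: submodD; rewrite -opprB; apply/submodN/quot_reprP.
Qed.

Lemma quot_piZ a m : quot_pi (a *: m) = quot_scale a (quot_pi m).
Proof.
apply/quot_piP => /=; rewrite -scalerBr; apply: submodZ.
by rewrite -opprB; apply/submodN/quot_reprP.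
Qed.

Fact quot_addA : associative quot_add.
Proof.
move=> x y z; rewrite -(quot_piK x) -(quot_piK y) -(quot_piK z).
by rewrite -!quot_piD addrA.
Qed.
Fact quot_addC : commutative quot_add.
Proof. by move=> x y; rewrite /quot_add addrC. Qed.
Fact quot_add0 : left_id (quot_pi 0) quot_add.
Proof. by move=> x; rewrite -(quot_piK x) -quot_piD add0r. Qed.
Fact quot_addN : left_inverse (quot_pi 0) quot_opp quot_add.
Proof.
by move=> x; rewrite /quot_opp -{2}(quot_piK x) -quot_piD addNr.
Qed.

HB.instance Definition _ :=
  GRing.isZmodule.Build quot quot_addA quot_addC quot_add0 quot_addN.

Fact quot_scaleA a b v : quot_scale a (quot_scale b v) = quot_scale (a * b) v.
Proof.
by rewrite -(quot_piK v) -!quot_piZ scalerA.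
Qed.
Fact quot_scale1 : left_id 1 quot_scale.
Proof. by move=> x; rewrite /quot_scale scale1r quot_piK. Qed.
Fact quot_scaleDr : right_distributive quot_scale +%R.
Proof.
move=> a x y; rewrite -(quot_piK x) -(quot_piK y).
rewrite -[_ + _]quot_piD -!quot_piZ scalerDr.
exact: quot_piD.
Qed.
Fact quot_scaleDl v : {morph quot_scale^~ v : a b / a + b}.
Proof. by move=> a b; rewrite /quot_scale scalerDl; apply: quot_piD. Qed.

HB.instance Definition _ := GRing.Zmodule_isLmodule.Build R quot
  quot_scaleA quot_scale1 quot_scaleDr quot_scaleDl.

Lemma quot_exists :
  exists (Q : lmodType R) (q : {linear M -> Q}),
    (forall y, exists m, q m = y) /\ (forall m, q m = 0 <-> U m).
Proof.
have [|q qE] := @linear_of R M quot quot_pi.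
  by move=> a x y; rewrite quot_piD quot_piZ.
exists quot, q; split=> [y|m]; first by exists (val y); rewrite qE quot_piK.
rewrite qE; have := quot_piP m 0; rewrite subr0 => <-.
by [].
Qed.

End Quotient.

Lemma ker_submod (R : pzRingType) (A B : lmodType R) (f : {linear A -> B}) :
  is_submod (fun a => f a = 0).
Proof.
split=> [|a x y fx fy]; first by rewrite linear0.
by rewrite linearP fx fy scaler0 addr0.
Qed.

Lemma im_submod (R : pzRingType) (A B : lmodType R) (f : {linear A -> B}) :
  is_submod (fun b => exists a, f a = b).
Proof.
split=> [|a _ _ [x <-] [y <-]]; first by exists 0; rewrite linear0.
by exists (a *: x + y); rewrite linearP.
Qed.

Definition surj (A B : Type) (f : A -> B) := forall y, exists x, f x = y.

Lemma ker_exists (R : pzRingType) (A B : lmodType R) (f : {linear A -> B}) :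
  exists (K : lmodType R) (k : {linear K -> A}),
    injective k /\ (forall a, f a = 0 <-> exists x, k x = a).
Proof. exact: (submod_exists (ker_submod f)). Qed.

Lemma coker_exists (R : pzRingType) (A B : lmodType R) (f : {linear A -> B}) :
  exists (Q : lmodType R) (q : {linear B -> Q}),
    surj q /\ (forall b, q b = 0 <-> exists a, f a = b).
Proof. exact: (quot_exists (im_submod f)). Qed.

Lemma lift_inj (R : pzRingType) (K A B : lmodType R)
    (k : {linear K -> A}) (f : {linear B -> A}) :
  injective k -> (forall b, exists x, k x = f b) ->
  exists g : {linear B -> K}, forall b, k (g b) = f b.
Proof.
move=> kI /choice[g gE].
have [|g' g'E] := @linear_of R B K g.
  by move=> a x y; apply: kI; rewrite linearP !gE linearP.
by exists g' => b; rewrite g'E.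
Qed.

Lemma fact_surj (R : pzRingType) (B Q C : lmodType R)
    (q : {linear B -> Q}) (f : {linear B -> C}) :
  surj q -> (forall b, q b = 0 -> f b = 0) ->
  exists g : {linear Q -> C}, forall b, g (q b) = f b.
Proof.
move=> qS qf; have [s sE] := choice qS.
have fE b b' : q b = q b' -> f b = f b'.
  by move=> e; apply/eqP; rewrite -subr_eq0 -linearB qf // linearB e subrr.
have [|g gE] := @linear_of R Q C (f \o s).
  by move=> a x y /=; rewrite -linearP; apply: fE; rewrite linearP !sE.
by exists g => b; rewrite gE /=; apply: fE; rewrite sE.
Qed.

(** * Short exact sequences *)

Definition ses (R : pzRingType) (A B C : lmodType R)
    (i : {linear A -> B}) (p : {linear B -> C}) : Prop :=
  [/\ injective i, surj p & forall b, p b = 0 <-> exists a, i a = b].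

Section ShortExact.
Variable R : pzRingType.
Implicit Types A B C E G K L M N P W Y Z : lmodType R.

Lemma linear_inj A B (f : {linear A -> B}) :
  (forall a, f a = 0 -> a = 0) -> injective f.
Proof.
move=> f0 x y e; apply/eqP; rewrite -subr_eq0; apply/eqP/f0.
by rewrite linearB e subrr.
Qed.

Lemma ses_comp0 A B C (i : {linear A -> B}) (p : {linear B -> C}) a :
  ses i p -> p (i a) = 0.
Proof. by case=> _ _ ex; apply/ex; exists a. Qed.

(** For M inside G inside P, the module L is P / M, an extension of P / G by G / M. *)
Lemma ses_third_iso M G Z P K
    (i : {linear M -> G}) (p : {linear G -> Z})
    (j : {linear G -> P}) (q : {linear P -> K}) :
  ses i p -> ses j q ->
  exists L (l : {linear P -> L}) (z : {linear Z -> L}) (r : {linear L -> K}),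
    ses (j \o i) l /\ ses z r.
Proof.
move=> sM sG; have [iI pS iE] := sM; have [jI qS jE] := sG.
have [L [l [lS lE]]] := coker_exists (j \o i).
have [|z zE] := @fact_surj _ _ _ _ p (l \o j) pS.
  by move=> g /iE[m <-] /=; apply/lE; exists m.
have [|r rE] := @fact_surj _ _ _ _ l q lS.
  by move=> x /lE[m <-] /=; apply: ses_comp0 sG.
exists L, l, z, r; split; first by split=> //; apply: inj_comp.
split=> [|k|x].
- apply: linear_inj => t; have [g <-] := pS t.
  by rewrite zE => /lE[m /= /jI <-]; apply: ses_comp0 sM.
- by have [x <-] := qS k; exists (l x).
- have [y <-] := lS x; rewrite rE; split=> [/jE[g <-]|[t]].
    by exists (p g); rewrite zE.
  have [g <-] := pS t; rewrite zE /= => /(congr1 r).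
  by rewrite !rE => <-; apply: ses_comp0 sG.
Qed.

(** Here L is the preimage of A in W, that is, the kernel of W -> B; it contains K with quotient
    A. *)
Lemma ses_preimage K W E A B
    (k : {linear K -> W}) (w : {linear W -> E})
    (a : {linear A -> E}) (b : {linear E -> B}) :
  ses k w -> ses a b ->
  exists L (l : {linear L -> W}) (k' : {linear K -> L}) (u : {linear L -> A}),
    [/\ ses l (b \o w), ses k' u & forall x, l (k' x) = k x].
Proof.
move=> sK sA; have [kI wS kE] := sK; have [aI bS aE] := sA.
have [L [l [lI lE]]] := ker_exists (b \o w).
have [|k' k'E] := @lift_inj _ _ _ _ l k lI.
  by move=> x; apply/lE => /=; rewrite (ses_comp0 _ sK) linear0.
have [|u uE] := @lift_inj _ _ _ _ a (w \o l) aI.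
  by move=> x; apply/aE; apply/(lE (l x)); exists x.
exists L, l, k', u; split=> //; split=> //.
- by move=> y; have [e <-] := bS y; have [x <-] := wS e; exists x.
- by move=> x y e; apply: kI; rewrite -!k'E e.
- move=> y; have [x xE] := wS (a y).
  have [t tE] : exists t, l t = x by apply/lE; rewrite /= xE (ses_comp0 _ sA).
  by exists t; apply: aI; rewrite uE /= tE.
- move=> x; split=> [ux|[t <-]].
    have /kE[t tE] : w (l x) = 0 by rewrite -[w _]uE ux linear0.
    by exists t; apply: lI; rewrite k'E.
  by apply: aI; rewrite uE /= k'E (ses_comp0 _ sK) linear0.
Qed.

Lemma pair_linear A B C (f : {linear A -> B}) (g : {linear A -> C}) :
  exists h : {linear A -> (B * C)%type}, forall a, h a = (f a, g a).
Proof. by apply: linear_of => a x y; rewrite !linearP. Qed.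

Lemma copair_linear A B C (f : {linear A -> C}) (g : {linear B -> C}) :
  exists h : {linear (A * B)%type -> C}, forall a b, h (a, b) = f a + g b.
Proof.
have [|h hE] := @linear_of R (A * B)%type C (fun x => f x.1 + g x.2).
  by move=> a x y /=; rewrite !linearP scalerDr addrACA.
by exists h => a b; rewrite hE.
Qed.

Lemma fst_linear A B : exists h : {linear (A * B)%type -> A}, forall x, h x = x.1.
Proof. by apply: linear_of => a x y. Qed.

Lemma snd_linear A B : exists h : {linear (A * B)%type -> B}, forall x, h x = x.2.
Proof. by apply: linear_of => a x y. Qed.

Lemma sub_linear A B (f g : {linear A -> B}) :
  exists h : {linear A -> B}, forall x, h x = f x - g x.
Proof.
by apply: linear_of => a x y; rewrite !linearP scalerDr addrACA.
Qed.

(** E is the quotient of L x G by the pairs (z t, - i t); pushing out preserves both cokernels. *)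
Lemma ses_pushout Z L K G Y
    (z : {linear Z -> L}) (r : {linear L -> K})
    (i : {linear Z -> G}) (p : {linear G -> Y}) :
  ses z r -> ses i p ->
  exists E (g : {linear G -> E}) (r' : {linear E -> K})
      (l : {linear L -> E}) (p' : {linear E -> Y}), ses g r' /\ ses l p'.
Proof.
move=> sL sG; have [zI rS zE] := sL; have [iI pS iE] := sG.
have [i' i'E] := sub_linear (\0 : {linear Z -> G}) i. rewrite /= in i'E.
have [j jE] := pair_linear z i'.
have [E [q [qS qE]]] := coker_exists j.
have q0 x y : q (x, y) = 0 -> exists t, z t = x /\ i t = - y.
  by move=> /qE[t]; rewrite jE i'E sub0r => -[<- <-]; exists t; rewrite opprK.
have qj t : q (z t, - i t) = 0.
  by apply/qE; exists t; rewrite jE i'E sub0r.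
have [l0 l0E] := pair_linear (idfun : {linear L -> L}) (\0 : {linear L -> G}).
rewrite /= in l0E.
have [g0 g0E] := pair_linear (\0 : {linear G -> L}) (idfun : {linear G -> G}).
rewrite /= in g0E.
have [r0 r0E] := copair_linear r (\0 : {linear G -> K}).
rewrite /= in r0E.
have [p0 p0E] := copair_linear (\0 : {linear L -> Y}) p.
rewrite /= in p0E.
have [|r' r'E] := @fact_surj _ _ _ _ q r0 qS.
  by move=> [x y] /q0[t [<- _]]; rewrite r0E (ses_comp0 _ sL) addr0.
have [|p' p'E] := @fact_surj _ _ _ _ q p0 qS.
  move=> [x y] /q0[t [_ /esym/eqP]]; rewrite eqr_oppLR => /eqP ->.
  by rewrite p0E linearN (ses_comp0 _ sG) oppr0 addr0.
have r'q x y : r' (q (x, y)) = r x by rewrite r'E r0E addr0.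
have p'q x y : p' (q (x, y)) = p y by rewrite p'E p0E add0r.
exists E, (q \o g0), r', (q \o l0), p'; split; split.
- apply: linear_inj => y /=; rewrite g0E => /q0[t []].
  rewrite -(linear0 z) => /zI ->; rewrite linear0 => /esym/eqP.
  by rewrite oppr_eq0 => /eqP.
- by move=> k; have [x <-] := rS k; exists (q (x, 0)).
- move=> e; have [[x y] <-] := qS e; rewrite r'q; split=> [/zE[t <-]|[y' /=]].
    exists (y + i t); rewrite /= g0E; apply/eqP; rewrite -subr_eq0 -linearB.
    have -> : (0, y + i t) - (z t, y) = - (z t, - i t) :> L * G.
      by congr pair; rewrite /= ?sub0r ?opprK // addrC addKr.
    by rewrite linearN qj oppr0.
  by rewrite g0E => /(congr1 r'); rewrite !r'q linear0.
- apply: linear_inj => x /=; rewrite l0E => /q0[t [<-]].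
  by rewrite /= oppr0 -(linear0 i) => /iI ->; rewrite linear0.
- by move=> k; have [y <-] := pS k; exists (q (0, y)).
- move=> e; have [[x y] <-] := qS e; rewrite p'q; split=> [/iE[t <-]|[x' /=]].
    exists (x + z t); rewrite /= l0E; apply/eqP; rewrite -subr_eq0 -linearB.
    have -> : (x + z t, 0) - (x, i t) = (z t, - i t) :> L * G.
      by congr pair; rewrite /= ?sub0r // addrC addKr.
    by rewrite qj.
  by rewrite l0E => /(congr1 p'); rewrite !p'q linear0.
Qed.

Lemma ses_pullback K A Y Z G
    (k : {linear K -> A}) (f : {linear A -> Y})
    (i : {linear Z -> G}) (p : {linear G -> Y}) :
  ses k f -> ses i p ->
  exists E (k' : {linear K -> E}) (f' : {linear E -> G})
      (i' : {linear Z -> E}) (p' : {linear E -> A}),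
    [/\ ses k' f', ses i' p', forall x, p' (k' x) = k x &
        forall x, f' (i' x) = i x].
Proof.
move=> sA sG; have [kI fS kE] := sA; have [iI pS iE] := sG.
have [p_ p_E] := sub_linear (\0 : {linear G -> Y}) p.
rewrite /= in p_E.
have [d dE] := copair_linear f p_.
have [E [e [eI eE]]] := ker_exists d.
have [fs fsE] := fst_linear A G; have [sn snE] := snd_linear A G.
have eP a g : f a = p g <-> exists x, e x = (a, g).
  rewrite -eE dE p_E sub0r; split=> [->|/eqP]; first by rewrite subrr.
  by rewrite subr_eq0 => /eqP.
have ee x : f (e x).1 = p (e x).2.
  by apply/eP; exists x; rewrite -surjective_pairing.
have [k0 k0E] := pair_linear k (\0 : {linear K -> G}).
rewrite /= in k0E.
have [i0 i0E] := pair_linear (\0 : {linear Z -> A}) i.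
rewrite /= in i0E.
have [|k' k'E] := @lift_inj _ _ _ _ e k0 eI.
  by move=> x; rewrite k0E; apply/eP; rewrite linear0 (ses_comp0 _ sA).
have [|i' i'E] := @lift_inj _ _ _ _ e i0 eI.
  by move=> x; rewrite i0E; apply/eP; rewrite linear0 (ses_comp0 _ sG).
exists E, k', (sn \o e), i', (fs \o e); split.
- split.
  + move=> x y /(congr1 e); rewrite !k'E !k0E => -[]; exact: kI.
  + move=> g; have [a aE] := fS (p g); have [x xE] := (eP a g).1 aE.
    by exists x; rewrite /= snE xE.
  + move=> x /=; rewrite snE; split=> [x2|[y <-]]; last by rewrite k'E k0E.
    have := ee x; rewrite x2 linear0 => /kE[y yE]; exists y; apply: eI.
    by rewrite k'E k0E yE [RHS]surjective_pairing x2.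
- split.
  + move=> x y /(congr1 e); rewrite !i'E !i0E => -[]; exact: iI.
  + move=> a; have [g gE] := pS (f a); have [x xE] := (eP a g).1 (esym gE).
    by exists x; rewrite /= fsE xE.
  + move=> x /=; rewrite fsE; split=> [x2|[y <-]]; last by rewrite i'E i0E.
    have := ee x; rewrite x2 linear0 => /esym/iE[y yE]; exists y; apply: eI.
    by rewrite i'E i0E yE [RHS]surjective_pairing x2.
- by move=> x /=; rewrite fsE k'E k0E.
- by move=> x /=; rewrite snE i'E i0E.
Qed.

(** * Extension of maps and vanishing of Ext *)

Definition extends A B (i : {linear A -> B}) N : Prop :=
  forall h : {linear A -> N}, exists h' : {linear B -> N}, forall a, h' (i a) = h a.

(* [Ext^1(M, N) = 0], in the form needed for dimension shifting. *)
Definition orth M N : Prop :=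
  forall K A (k : {linear K -> A}) (f : {linear A -> M}), ses k f -> extends k N.

Lemma orth_proj P N : projective_mod P -> orth P N.
Proof.
move=> Pproj K A k f sK h; have [kI fS kE] := sK.
have [s sE] := Pproj _ _ f idfun fS.
have [d dE] := sub_linear (idfun : {linear A -> A}) (s \o f).
have [|g gE] := @lift_inj _ _ _ _ k d kI.
  by move=> a; apply/kE; rewrite dE linearB /= sE subrr.
exists (h \o g) => a /=; congr (h _); apply: kI.
by rewrite gE dE /= (ses_comp0 _ sK) linear0 subr0.
Qed.

(** Exactness of Hom(G, N) -> Hom(Z, N) -> Ext^1(Y, N) -> Ext^1(G, N) by hand: on the pullback of A
    along [p] the map [h] extends because Ext^1(G, N) = 0; subtracting an extension to G of its
    restriction to Z makes it descend to A. *)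
Lemma orth_quotient Z G Y N (i : {linear Z -> G}) (p : {linear G -> Y}) :
  ses i p -> orth G N -> extends i N -> orth Y N.
Proof.
move=> sG GN iN K A k f sA h; have [kI fS kE] := sA.
have [E [k' [f' [i' [p' [sk' si' p'k' f'i']]]]]] := ses_pullback sA sG.
have [w wE] := GN _ _ _ _ sk' h.
have [v vE] := iN (w \o i').
have [d dE] := sub_linear w (v \o f').
have [_ p'S p'E] := si'.
have [|h' h'E] := @fact_surj _ _ _ _ p' d p'S.
  by move=> x /p'E[t <-]; rewrite dE /= f'i' vE /= subrr.
exists h' => x; rewrite -p'k' h'E dE wE /= (ses_comp0 _ sk') linear0.
by rewrite subr0.
Qed.

(** A map is extended from K to the preimage of A in W, and from there, with quotient B, to all of
    W. *)
Lemma orth_ses A E B N (a : {linear A -> E}) (b : {linear E -> B}) :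
  ses a b -> orth A N -> orth B N -> orth E N.
Proof.
move=> sE AN BN K W k w sW h.
have [L [l [k' [u [sl sk' lk']]]]] := ses_preimage sW sE.
have [h1 h1E] := AN _ _ _ _ sk' h.
have [h2 h2E] := BN _ _ _ _ sl h1.
by exists h2 => x; rewrite -lk' h2E h1E.
Qed.

End ShortExact.

(** * Syzygies of acyclic complexes *)

Section Syzygies.
Variable R : pzRingType.
Variables (X NN : lmodType R -> Prop).
Implicit Types (M N : lmodType R) (C : complex R).

(** The piece of a complex between consecutive syzygies. For a short exact sequence, exactness of
    Hom(-, N) comes down to extending maps from M to G. *)
Definition link M M' : Prop :=
  exists (G : lmodType R) (i : {linear M -> G}) (p : {linear G -> M'}),
    [/\ X G, ses i p & forall N, NN N -> extends i N].

Definition hom_acyclic C N : Prop :=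
  forall n (c : {linear cobj C (n + 1)%R -> N}), (forall x, c (cdif C n x) = 0) ->
  exists c' : {linear cobj C (n + 1 + 1)%R -> N},
    forall x, c x = c' (cdif C (n + 1)%R x).

(** The syzygy is described as a kernel instead of an image, which avoids an index shift; the two
    agree in an acyclic complex. *)
Definition cycle_embedding M C n (f : {linear M -> cobj C n}) : Prop :=
  injective f /\ forall y, cdif C n y = 0 <-> exists m, f m = y.

Definition syzygy M : Prop :=
  exists C, [/\ forall n, X (cobj C n), acyclic C,
    forall N, NN N -> hom_acyclic C N &
    exists n (f : {linear M -> cobj C n}), cycle_embedding f].

Lemma int_succ (n : int) : exists m, n = m + 1.
Proof. by exists (n - 1); rewrite subrK. Qed.

Lemma cycle_corestrict M C n (f : {linear M -> cobj C (n + 1)%R}) :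
  acyclic C -> cycle_embedding f ->
  exists p : {linear cobj C n -> M}, surj p /\ forall x, f (p x) = cdif C n x.
Proof.
move=> acC [fI fE]; have [dd ex] := acC n.
have [|p pE] := @lift_inj _ _ _ _ f (cdif C n) fI.
  by move=> x; apply/fE/dd.
exists p; split=> // m.
have /ex[y yE] : cdif C (n + 1) (f m) = 0 by apply/fE; exists m.
by exists y; apply: fI; rewrite pE.
Qed.

(** Composed with the surjection [p] onto M, the map [h] becomes a cocycle, so h p = c' d = c' f p,
    and [p] cancels. The degree is rewritten as [k + 1 + 1] to match [hom_acyclic]. *)
Lemma cycle_extends M C n (f : {linear M -> cobj C n}) N :
  acyclic C -> hom_acyclic C N -> cycle_embedding f -> extends f N.
Proof.
have [m eqn] := int_succ n; subst n.
have [k eqm] := int_succ m; subst m.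
move=> acC hC fP h; have [p [pS pE]] := cycle_corestrict acC fP.
have [fI fE] := fP.
have [|c' c'E] := hC k (h \o p).
  move=> x /=; have -> : p (cdif C k x) = 0.
    by apply: fI; rewrite pE linear0; case: (acC k).
  by rewrite linear0.
by exists c' => m; have [x <-] := pS m; rewrite pE -c'E.
Qed.

Lemma cycle_next M C n (f : {linear M -> cobj C n}) :
  acyclic C -> cycle_embedding f ->
  exists M' (f' : {linear M' -> cobj C (n + 1)%R}) (p : {linear cobj C n -> M'}),
    cycle_embedding f' /\ ses f p.
Proof.
move=> acC [fI fE].
have [M' [f' [f'I f'E]]] := ker_exists (cdif C (n + 1)).
have f'P : cycle_embedding f' by [].
have [p [pS pE]] := cycle_corestrict acC f'P.
exists M', f', p; split=> //; split=> // y.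
rewrite -fE -pE; split=> [->|e]; first by rewrite linear0.
by apply: f'I; rewrite e linear0.
Qed.

Lemma cycle_prev M C n (f : {linear M -> cobj C (n + 1)%R}) :
  acyclic C -> cycle_embedding f ->
  exists M' (f' : {linear M' -> cobj C n}) (p : {linear cobj C n -> M}),
    cycle_embedding f' /\ ses f' p.
Proof.
move=> acC fP; have [fI fE] := fP.
have [M' [f' [f'I f'E]]] := ker_exists (cdif C n).
have [p [pS pE]] := cycle_corestrict acC fP.
exists M', f', p; split=> //; split=> // y.
rewrite -f'E -pE; split=> [->|e]; first by rewrite linear0.
by apply: fI; rewrite e linear0.
Qed.

Lemma syzygy_next M : syzygy M -> exists M', syzygy M' /\ link M M'.
Proof.
move=> [C [XC acC hC [n [f fP]]]].
have [M' [f' [p [f'P sf]]]] := cycle_next acC fP.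
exists M'; split; first by exists C; split=> //; exists (n + 1), f'.
exists (cobj C n), f, p; split=> // N NN_N.
by apply: cycle_extends acC _ fP; apply: hC.
Qed.

Lemma syzygy_prev M : syzygy M -> exists M', syzygy M' /\ link M' M.
Proof.
move=> [C [XC acC hC [n [f fP]]]].
have [m eqn] := int_succ n; subst n.
have [M' [f' [p [f'P sf]]]] := cycle_prev acC fP.
exists M'; split; first by exists C; split=> //; exists m, f'.
exists (cobj C m), f', p; split=> // N NN_N.
by apply: cycle_extends acC _ f'P; apply: hC.
Qed.

Lemma dependent_sequence (T : Type) (S : T -> Prop) (Q : T -> T -> Prop) (t : T) :
  S t -> (forall x, S x -> exists y, S y /\ Q x y) ->
  exists u : nat -> T, u 0%N = t /\ forall k, Q (u k) (u k.+1).
Proof.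
move=> St step.
have [|g gE] := @choice {x | S x} {x | S x} (fun x y => Q (sval x) (sval y)).
  by move=> [x Sx]; have [y [Sy Qxy]] := step x Sx; exists (exist _ y Sy).
by exists (fun k => sval (iter k g (exist _ t St))).
Qed.

(** Links are spliced with differentials i p. A cocycle on the middle term kills the kernel of its
    [p], so it factors through the next syzygy and extends along the next [i]. *)
Lemma chain_syzygy (z : int -> lmodType R) :
  (forall n, link (z n) (z (n + 1))) -> syzygy (z 0).
Proof.
move=> zE.
pose G n := projT1 (cid (zE n)).
pose i n := projT1 (cid (projT2 (cid (zE n)))) : {linear z n -> G n}.
pose p n := projT1 (cid (projT2 (cid (projT2 (cid (zE n)))))) :
  {linear G n -> z (n + 1)}.
have GP n : [/\ X (G n), ses (i n) (p n) & forall N, NN N -> extends (i n) N].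
  exact: (projT2 (cid (projT2 (cid (projT2 (cid (zE n))))))).
exists (@Complex R G (fun n => i (n + 1) \o p n : {linear _ -> _})); split => /=.
- by move=> n; case: (GP n).
- move=> n /=; have [_ sn _] := GP n; have [_ sn1 _] := GP (n + 1).
  have [_ sn2 _] := GP (n + 1 + 1).
  split=> [y|x xE]; first by rewrite (ses_comp0 _ sn1) linear0.
  have [_ _ ex1] := sn1; have [i2I _ _] := sn2.
  have /ex1[t <-] : p (n + 1) x = 0 by apply: i2I; rewrite xE linear0.
  by have [_ pS _] := sn; have [y <-] := pS t; exists y.
- move=> N NN_N n c /= cE.
  have [_ [_ pS _] _] := GP n; have [_ [_ pS1 ex1] _] := GP (n + 1).
  have [_ _ /(_ _ NN_N) ext2] := GP (n + 1 + 1).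
  have [|g gE] := @fact_surj _ _ _ _ (p (n + 1)) c pS1.
    by move=> b /ex1[t <-]; have [y <-] := pS t; apply: cE.
  by have [c' c'E] := ext2 g; exists c' => x; rewrite c'E gE.
- have [_ [iI _ ex] _] := GP 0; have [_ [i1I _ _] _] := GP (0 + 1).
  exists 0, (i 0); split=> //= y; rewrite -ex; split=> [e|->].
    by apply: i1I; rewrite e linear0.
  by rewrite linear0.
Qed.

(** The two halves of a complex are grown independently: each class need only reproduce itself in
    its own direction, and the halves meet at M. *)
Lemma syzygy_of_classes (SR SL : lmodType R -> Prop) M :
  SR M -> (forall M, SR M -> exists M', SR M' /\ link M M') ->
  SL M -> (forall M, SL M -> exists M', SL M' /\ link M' M) ->
  syzygy M.
Proof.
move=> SRM SRn SLM SLp.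
have [r [r0 rE]] := @dependent_sequence _ _ _ _ SRM SRn.
have [l [l0 lE]] := @dependent_sequence _ _ (fun x y => link y x) _ SLM SLp.
(* [Negz k] is -(k + 1), so [l k.+1] sits there and degree 0 holds [r 0], which equals [l 0]. *)
pose z (n : int) := match n with Posz k => r k | Negz k => l k.+1 end.
rewrite -r0; apply: (@chain_syzygy z) => -[k|[|k]].
- have -> : Posz k + 1 = Posz k.+1 by rewrite -addn1 PoszD.
  exact: rE.
- by have -> : Negz 0 + 1 = 0 by []; rewrite /= r0 -l0; apply: lE.
- have -> : Negz k.+1 + 1 = Negz k by rewrite !NegzE -addn1 PoszD opprD addrNK.
  exact: lE.
Qed.

End Syzygies.

(** * Stability *)

Section Stability.
Variable R : pzRingType.
Variable NN : lmodType R -> Prop.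
Implicit Types (A B E G K L M N P Q Z : lmodType R).

Local Notation Proj := (@projective_mod R).
Local Notation GP := (syzygy Proj NN).
Local Notation GP2 := (syzygy GP NN).

Lemma projective_prod P Q : Proj P -> Proj Q -> Proj (P * Q)%type.
Proof.
move=> Pp Qp A B g h gS.
have [i1 i1E] := pair_linear (idfun : {linear P -> P}) (\0 : {linear P -> Q}).
have [i2 i2E] := pair_linear (\0 : {linear Q -> P}) (idfun : {linear Q -> Q}).
rewrite /= in i1E i2E.
have [k1 k1E] := Pp _ _ g (h \o i1) gS.
have [k2 k2E] := Qp _ _ g (h \o i2) gS.
have [k kE] := copair_linear k1 k2.
exists k => -[p q]; rewrite kE linearD k1E k2E /= i1E i2E -linearD.
by congr (h (_, _)); rewrite /= ?addr0 ?add0r.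
Qed.

(** P is the image of the identity in 0 -> P -> P -> 0. The zero module is obtained as cokernel or
    kernel of an identity map. *)
Lemma projective_syzygy P : Proj P -> GP P.
Proof.
have step P' : Proj P' -> exists O', Proj O' /\ link Proj NN P' O'.
  move=> P'p.
  have [O' [q [qS qE]]] := coker_exists (idfun : {linear P' -> P'}).
  have O'0 (x : O') : x = 0.
    by have [y <-] := qS x; apply/qE; exists y.
  exists O'; split.
    move=> A B g h gS; exists (\0 : {linear O' -> A}) => p.
    by rewrite /= (O'0 p) !linear0.
  exists P', (idfun : {linear P' -> P'}), q; split=> //.
  by move=> N _ h; exists h.
have pets P' : Proj P' -> exists O', Proj O' /\ link Proj NN O' P'.
  move=> P'p.
  have [O' [q [qI qE]]] := ker_exists (idfun : {linear P' -> P'}).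
  have O'0 (x : O') : x = 0.
    by apply: qI; rewrite linear0; apply/qE; exists x.
  exists O'; split.
    move=> A B g h gS; exists (\0 : {linear O' -> A}) => p.
    by rewrite /= (O'0 p) !linear0.
  exists P', q, (idfun : {linear P' -> P'}); split=> //.
    by split=> // y; exists y.
  move=> N _ h; exists (\0 : {linear P' -> N}) => p.
  by rewrite /= (O'0 p) !linear0.
by move=> Pp; apply: (@syzygy_of_classes _ _ _ Proj Proj).
Qed.

Lemma syzygy_mono (X Y : lmodType R -> Prop) M :
  (forall M, X M -> Y M) -> syzygy X NN M -> syzygy Y NN M.
Proof.
move=> XY [C [XC acC hC MC]]; exists C; split=> // n; exact: XY.
Qed.

Lemma link_orth (X : lmodType R -> Prop) Z M N :
  (forall G, X G -> orth G N) -> NN N -> link X NN Z M -> orth M N.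
Proof.
move=> XN NN_N [G [i [p [XG sG ext]]]].
by apply: orth_quotient sG (XN _ XG) _; apply: ext.
Qed.

Lemma GP_orth M N : NN N -> GP M -> orth M N.
Proof.
move=> NN_N /syzygy_prev[Z [_ ZM]].
by apply: link_orth ZM => // G Gp; apply: orth_proj.
Qed.

Lemma GP2_orth M N : NN N -> GP2 M -> orth M N.
Proof.
move=> NN_N /syzygy_prev[Z [_ ZM]].
by apply: link_orth ZM => // G; apply: GP_orth.
Qed.

Hypothesis GP_orth_proj : forall M P, GP M -> Proj P -> orth M P.

Definition ext_of_GP E : Prop :=
  exists A B (a : {linear A -> E}) (b : {linear E -> B}),
    [/\ GP A, GP B & ses a b].

Lemma ext_of_GP_orth E N : NN N -> ext_of_GP E -> orth E N.
Proof.
move=> NN_N [A [B [a [b [GA GB sE]]]]].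
by apply: orth_ses sE _ _; apply: GP_orth.
Qed.

(** A horseshoe construction for coresolutions: E embeds into P x Q with cokernel an extension of B'
    by A'. The cokernel is again of the same kind, which gives exactness of Hom(-, N). *)
Lemma ext_of_GP_next E :
  ext_of_GP E -> exists E', ext_of_GP E' /\ link Proj NN E E'.
Proof.
move=> [A [B [a [b [GA GB sE]]]]]; have [aI bS ex] := sE.
have [A' [GA' [P [i [p [Pp sA _]]]]]] := syzygy_next GA.
have [B' [GB' [Q [j [q [Qp sB _]]]]]] := syzygy_next GB.
have [iI pS pE] := sA; have [jI qS qE] := sB.
(* P is not injective, so extending A -> P to E is exactly where Ext^1(B, P) = 0 enters. *)
have [i' i'E] := GP_orth_proj GB Pp sE i.
have [u uE] := pair_linear i' (j \o b).
have uI : injective u.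
  apply: linear_inj => e; rewrite uE => -[ie /=]; rewrite -(linear0 j).
  move=> /jI/ex[x xE]; move: ie; rewrite -xE i'E -(linear0 i) => /iI ->.
  by rewrite linear0.
have [E' [w [wS wE]]] := coker_exists u.
have su : ses u w by [].
have [i1 i1E] := pair_linear (idfun : {linear P -> P}) (\0 : {linear P -> Q}).
have [q0 q0E] := copair_linear (\0 : {linear P -> B'}) q.
rewrite /= in i1E q0E.
have [|a' a'E] := @fact_surj _ _ _ _ p (w \o i1) pS.
  move=> x /pE[y <-]; apply/wE; exists (a y).
  by rewrite uE i1E i'E /= (ses_comp0 _ sE) linear0.
have [|b' b'E] := @fact_surj _ _ _ _ w q0 wS.
  by move=> _ /wE[e <-]; rewrite uE q0E /= (ses_comp0 _ sB) addr0.
have sE' : ses a' b'.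
  split.
  - apply: linear_inj => x; have [y <-] := pS x.
    rewrite a'E /= i1E => /wE[e]; rewrite uE => -[ey /=].
    rewrite -(linear0 j) => /jI/ex[t tE].
    by move: ey; rewrite -tE i'E => <-; apply: ses_comp0 sA.
  - move=> y; have [z <-] := qS y; exists (w (0, z)).
    by rewrite b'E q0E add0r.
  - move=> y; have [[x z] <-] := wS y; rewrite b'E q0E add0r; split.
      move=> /qE[t]; have [e <-] := bS t => eE.
      exists (p (x - i' e)); rewrite a'E /= i1E.
      apply/eqP; rewrite -subr_eq0 -linearB; apply/eqP/wE; exists (- e).
      rewrite linearN uE /= eE.
      by congr pair; rewrite /= ?sub0r // addrC addrA addNr sub0r.
    move=> [t]; have [x' <-] := pS t; rewrite a'E /= i1E => /(congr1 b').
    by rewrite !b'E !q0E !add0r linear0 => <-.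
have GE' : ext_of_GP E' by exists A', B', a', b'.
exists E'; split=> //; exists (P * Q)%type, u, w; split=> //.
  exact: projective_prod.
by move=> N NN_N; apply: ext_of_GP_orth GE' _ _ _ _ su.
Qed.

Lemma ext_of_GP_prev E :
  ext_of_GP E -> exists E', ext_of_GP E' /\ link Proj NN E' E.
Proof.
move=> GE; have [A [B [a [b [GA GB sE]]]]] := GE; have [aI bS ex] := sE.
have [A' [GA' [P [i [p [Pp sA _]]]]]] := syzygy_prev GA.
have [B' [GB' [Q [j [q [Qp sB _]]]]]] := syzygy_prev GB.
have [iI pS pE] := sA; have [jI qS qE] := sB.
have [q' q'E] := Qp _ _ b q bS.
have [w wE] := copair_linear (a \o p) q'.
have bw x y : b (w (x, y)) = q y.
  by rewrite wE linearD /= (ses_comp0 _ sE) add0r q'E.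
have wS : surj w.
  move=> e; have [y yE] := qS (b e).
  have /ex[x xE] : b (e - q' y) = 0 by rewrite linearB q'E yE subrr.
  have [z zE] := pS x; exists (z, y).
  by rewrite wE /= zE xE subrK.
have [E' [u [uI uE]]] := ker_exists w.
have su : ses u w by [].
have [i1 i1E] := pair_linear i (\0 : {linear A' -> Q}).
rewrite /= in i1E.
have [|a' a'E] := @lift_inj _ _ _ _ u i1 uI.
  by move=> x; apply/uE; rewrite i1E wE /= (ses_comp0 _ sA) !linear0 addr0.
have [sn snE] := snd_linear P Q.
have u2 x : q (u x).2 = 0.
  by rewrite -(bw (u x).1) -surjective_pairing (ses_comp0 _ su) linear0.
have [|b' b'E] := @lift_inj _ _ _ _ j (sn \o u) jI.
  by move=> x /=; rewrite snE; apply/qE/u2.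
have sE' : ses a' b'.
  split.
  - apply: linear_inj => x /(congr1 u); rewrite a'E i1E linear0 => -[].
    by rewrite -(linear0 i) => /iI.
  - move=> y; have /ex[t tE] : b (q' (j y)) = 0 by rewrite q'E (ses_comp0 _ sB).
    have [z zE] := pS (- t).
    have /uE[x xE] : w (z, j y) = 0 by rewrite wE /= zE linearN tE addNr.
    by exists x; apply: jI; rewrite b'E /= snE xE.
  - move=> x; split=> [xE|[t <-]]; last first.
      by apply: jI; rewrite b'E /= snE a'E i1E linear0.
    have u20 : (u x).2 = 0 by rewrite -snE -[sn _]b'E xE linear0.
    have /pE[t tE] : p (u x).1 = 0.
      apply: aI; have := wE (u x).1 (u x).2.
      by rewrite -surjective_pairing (ses_comp0 _ su) u20 !linear0 addr0.
    exists t; apply: uI; rewrite a'E i1E tE.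
    by rewrite [RHS]surjective_pairing u20.
exists E'; split; first by exists A', B', a', b'.
exists (P * Q)%type, u, w; split=> //; first exact: projective_prod.
by move=> N NN_N; apply: ext_of_GP_orth GE _ _ _ _ su.
Qed.

Lemma GP_ses A E B (a : {linear A -> E}) (b : {linear E -> B}) :
  ses a b -> GP A -> GP B -> GP E.
Proof.
move=> sE GA GB; have GE : ext_of_GP E by exists A, B, a, b.
exact: (syzygy_of_classes GE ext_of_GP_next GE ext_of_GP_prev).
Qed.

(** The invariant for growing the coresolution. Exactness of Hom(-, N) on this sequence follows from
    Ext^1(Z, N) = 0. *)
Definition GP_over_GP2 M : Prop :=
  exists G Z (i : {linear M -> G}) (p : {linear G -> Z}),
    [/\ GP G, GP2 Z & ses i p].

Lemma GP_over_GP2_next M :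
  GP_over_GP2 M -> exists M', GP_over_GP2 M' /\ link Proj NN M M'.
Proof.
move=> [G [Z [i [p [GG GZ sM]]]]].
have [K [GK [P [j [q [Pp sG extG]]]]]] := syzygy_next GG.
have [Z1 [GZ1 [G1 [i1 [p1 [GG1 sZ _]]]]]] := syzygy_next GZ.
have [L [l [z [r [sP sL]]]]] := ses_third_iso sM sG.
have [E [g [r' [l' [p' [sE sLE]]]]]] := ses_pushout sL sZ.
exists L; split.
  by exists E, Z1, l', p'; split=> //; apply: GP_ses sE _ _.
(* A map from M extends to G since Ext^1(Z, N) = 0, and from G to P along the link of G. *)
exists P, (j \o i), l; split=> // N NN_N h.
have [h1 h1E] := GP2_orth NN_N GZ sM h.
have [h2 h2E] := extG _ NN_N h1.
by exists h2 => x; rewrite /= h2E h1E.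
Qed.

(** The dual invariant. Exactness of Hom(-, N) is carried along in [link], since it is what yields
    Ext^1(M, N) = 0. *)
Definition GP2_under_GP M : Prop := exists Z, GP2 Z /\ link GP NN Z M.

(** The kernel L of P -> G -> M is an extension of Z by G'. Pulling it back along G1 -> Z gives an
    extension E of G1 by G', which maps onto L with kernel Z1; maps from Z1 extend to E by way of
    G1. *)
Lemma GP2_under_GP_prev M :
  GP2_under_GP M -> exists M', GP2_under_GP M' /\ link Proj NN M' M.
Proof.
move=> [Z [GZ ZM]]; have [G [i [p [GG sM extM]]]] := ZM.
have [G' [GG' [P [j [q [Pp sG extG]]]]]] := syzygy_prev GG.
have [Z1 [GZ1 [G1 [i1 [p1 [GG1 sZ extZ]]]]]] := syzygy_prev GZ.
have [L [l [j' [u [sP sL _]]]]] := ses_preimage sG sM.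
have [E [k' [f' [i' [p' [sE sEL _ f'i']]]]]] := ses_pullback sL sZ.
exists L; split.
  exists Z1; split=> //; exists E, i', p'; split=> //.
    exact: GP_ses sE _ _.
  move=> N NN_N h; have [h1 h1E] := extZ _ NN_N h.
  by exists (h1 \o f') => x /=; rewrite f'i' h1E.
exists P, l, (p \o q); split=> // N NN_N.
apply: link_orth sP => //; last exact: ZM.
by move=> ? /GP_orth; apply.
Qed.

Theorem GP2_stable M : GP2 M <-> GP M.
Proof.
split=> GM; last by apply: syzygy_mono GM; apply: projective_syzygy.
have [Z' [GZ' [G [i [p [GG sG _]]]]]] := syzygy_next GM.
have [Z [GZ ZM]] := syzygy_prev GM.
apply: (@syzygy_of_classes _ _ _ GP_over_GP2 GP2_under_GP).
- by exists G, Z', i, p.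
- exact: GP_over_GP2_next.
- by exists Z.
- exact: GP2_under_GP_prev.
Qed.

End Stability.

(** * Characters of abelian groups *)

Section Characters.

Lemma int_subgroup (K : int -> Prop) :
  K 0 -> (forall k l, K k -> K l -> K (k - l)) ->
  exists n : nat, forall k, K k <-> exists q, k = q * n%:Z.
Proof.
move=> K0 KB.
have KN k : K k -> K (- k) by move=> Kk; rewrite -sub0r; apply: KB.
have KM n (q : int) : K n -> K (q * n).
  move=> Kn; have KMn m : K (m%:Z * n).
    elim: m => [|m IH]; first by rewrite mul0r.
    by rewrite -addn1 PoszD mulrDl mul1r -[n in _ + n]opprK; apply: KB => //; apply: KN.
  by case: q => m //; rewrite NegzE mulNr; apply: KN.
case: (pselect (exists n : nat, (0 < n)%N /\ K n%:Z)) => [ex|no]; last first.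
  exists 0%N => k; split=> [Kk|[q ->]]; last by rewrite mulr0.
  exists 0; rewrite mulr0; apply/eqP; rewrite -absz_eq0 -leqn0 leqNgt.
  apply/negP => k0; apply: no; exists `|k|%N; split=> //.
  by case: (intP k) Kk {k0} => // m Km; rewrite ?abszN //=; rewrite -[Posz _]opprK; apply: KN.
have {}ex : exists n : nat, (0 < n)%N && `[< K n%:Z >].
  by case: ex => n [n0 Kn]; exists n; rewrite n0; apply/asboolP.
have [n /andP[n0 /asboolP Kn] nmin] := ex_minnP ex.
exists n => k; split=> [Kk|[q ->]]; last exact: KM.
exists (k %/ n%:Z)%Z.
have kE := divz_eq k n.
have r0 : (0 <= (k %% n)%Z) by rewrite modz_ge0 // eqz_nat -lt0n.
have rn : ((k %% n)%Z < n%:Z) by rewrite ltz_pmod.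
have Kr : K (k %% n)%Z.
  have -> : (k %% n)%Z = k - (k %/ n)%Z * n by rewrite {2}kE addrC addKr.
  by apply: KB => //; apply: KM.
suff e : (k %% n)%Z = 0 by rewrite {1}kE e addr0.
case: (k %% n)%Z r0 rn Kr => // m _; rewrite ltz_nat => mn Km.
case: m mn Km => // m mn Km.
by have := nmin m.+1; rewrite (asboolT Km) => /(_ isT); rewrite leqNgt mn.
Qed.

(** The first clause makes D injective, the second makes characters of nonzero cyclic groups
    nontrivial; n = 0 stands for the infinite cyclic group. *)
Definition cogenerator (D : zmodType) : Prop :=
  (forall (n : nat) (x : D), (0 < n)%N -> exists y, y *+ n = x) /\
  (forall n : nat, n != 1%N -> exists x : D, x != 0 /\ x *+ n = 0).

(** The group is Q / Z, formed as a quotient of modules over the integers. *)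
Lemma cogenerator_exists : exists D : zmodType, cogenerator D.
Proof.
have hU : @is_submod int (zmodule rat) (fun q => exists z : int, q = z%:~R).
  split=> [|a _ _ [x ->] [y ->]]; first by exists 0.
  exists (a * x + y); rewrite intrD intrM mulrzl.
  by [].
have [Q [q [qS qE]]] := quot_exists hU.
exists Q; split=> [n x n0|n n1].
  have [r <-] := qS x; exists (q ((r : rat) / n%:R)); rewrite -raddfMn /=.
  by congr (q _); rewrite -[_ *+ n](mulr_natr (_ : rat)) divfK // pnatr_eq0 -lt0n.
have half m : (1 < m)%N -> q (m%:R^-1 : rat) != 0.
  move=> m1; apply/eqP => /qE[z] /(congr1 (fun t : rat => t * m%:R)).
  rewrite mulVf ?pnatr_eq0 -?lt0n ?(ltnW m1) // => /esym/eqP.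
  rewrite -[m%:R]/(m%:Z%:~R) -intrM -[1]/(1%:~R) eqr_int => /eqP e.
  have := congr1 absz e; rewrite abszM => /eqP; rewrite muln_eq1 => /andP[_ /eqP] /= mE.
  by rewrite mE in m1.
(* For n = 0 any nonzero class serves, here that of 1/2; for n >= 2 the class of 1/n is taken. *)
case: n n1 => [|[|n]] // _; first by exists (q (2%:R^-1 : rat)); rewrite mulr0n half.
exists (q (n.+2%:R^-1 : rat)); rewrite half //; split=> //; rewrite -raddfMn.
by apply/qE; exists 1; rewrite -[_ *+ _](mulr_natr (_ : rat)) mulVf // pnatr_eq0.
Qed.

Variables (D : zmodType) (DP : cogenerator D).

(** A homomorphism on a subgroup, encoded by its graph so that Zorn's lemma applies to sets of
    pairs. *)
Definition graph_hom (V : zmodType) (H : V -> D -> Prop) : Prop :=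
  [/\ H 0 0, forall u v s t, H u s -> H v t -> H (u - v) (s - t) &
      forall t, H 0 t -> t = 0].

Lemma graph_homMz (V : zmodType) (H : V -> D -> Prop) v t (k : int) :
  graph_hom H -> H v t -> H (v *~ k) (t *~ k).
Proof.
move=> [H00 HB _] Hvt.
have HN u s : H u s -> H (- u) (- s).
  by move=> Hus; rewrite -[- u]sub0r -[- s]sub0r; apply: HB.
have HMn n : H (v *+ n) (t *+ n).
  elim: n => [|n IH]; first by rewrite !mulr0n.
  by rewrite !mulrSr -[X in H (_ + X)]opprK -[X in H _ (_ + X)]opprK;
    apply: HB => //; apply: HN.
by case: k => n; [apply: HMn | apply/HN/HMn].
Qed.

(** Baer's step: the multiples of v in the domain are those of n v, with value s there; a y with n y
    = s is a consistent value at v. If n = 0, then s = 0 and y = 0 is taken. *)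
Lemma graph_hom_extend (V : zmodType) (H : V -> D -> Prop) v :
  graph_hom H ->
  exists H' : V -> D -> Prop, [/\ graph_hom H', forall u t, H u t -> H' u t &
    exists t, H' v t].
Proof.
move=> GH; have [H00 HB H0] := GH.
have HN u s : H u s -> H (- u) (- s).
  by move=> Hus; rewrite -[- u]sub0r -[- s]sub0r; apply: HB.
have [y yE] : exists y, forall k t, H (v *~ k) t -> t = y *~ k.
  have [||n nE] := @int_subgroup (fun k => exists t, H (v *~ k) t).
  - by exists 0; rewrite mulr0z.
  - by move=> k l [t Ht] [s Hs]; exists (t - s); rewrite mulrzBr; apply: HB.
  have [s Hs] : exists t, H (v *~ n%:Z) t by apply/nE; exists 1; rewrite mul1r.
  have [y yE] : exists y, y *+ n = s.
    case: n {nE} Hs => [|n] Hs; last exact: DP.1.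
    by exists 0; rewrite (H0 s).
  exists y => k t Ht; have [q kE] : exists q, k = q * n%:Z by apply/nE; exists t.
  have := graph_homMz q GH Hs; rewrite -mulrzA mulrC -kE => Hq.
  have := HB _ _ _ _ Ht Hq; rewrite subrr => /H0/eqP.
  by rewrite subr_eq0 => /eqP ->; rewrite -yE kE mulrC mulrzA.
exists (fun w s => exists u t k, [/\ H u t, w = u + v *~ k & s = t + y *~ k]).
split.
- split.
  + by exists 0, 0, 0; rewrite !mulr0z !addr0.
  + move=> _ _ _ _ [u1 [t1 [k1 [H1 -> ->]]]] [u2 [t2 [k2 [H2 -> ->]]]].
    exists (u1 - u2), (t1 - t2), (k1 - k2).
    by split; [exact: HB | rewrite mulrzBr opprD addrACA..].
  + move=> s [u [t [k [Hu /esym/eqP]]]]; rewrite addr_eq0 => /eqP uE ->.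
    have /yE -> : H (v *~ (- k)) t by rewrite mulrNz -uE.
    by rewrite mulrNz addNr.
- by move=> u t Ht; exists u, t, 0; rewrite !mulr0z !addr0.
- by exists y, 0, 0, 1; rewrite !mulr1z !add0r.
Qed.

Lemma character_extend (V : zmodType) (H : V -> D -> Prop) :
  graph_hom H -> exists chi : {additive V -> D}, forall v t, H v t -> chi v = t.
Proof.
move=> GH.
(* Adjoining H to every set makes the union of the empty chain admissible. *)
pose U (A : set (V * D)%type) v t := A (v, t) \/ H v t.
have [|A [GA Amax]] := @Zorn_bigcup (V * D)%type (fun A => graph_hom (U A)).
  move=> F FG Ftot.
  have [[X0 FX0]|F0] := pselect (exists X, F X); last first.
    have -> : U (\bigcup_(X in F) X)%classic = H.
      apply/funext => v; apply/funext => t; apply/propext.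
      by split=> [[[X FX]|//]|]; [case: F0; exists X | right].
    by [].
  have UE v t : U (\bigcup_(X in F) X)%classic v t <-> exists X, F X /\ U X v t.
    split=> [[[X FX Xv]|Hv]|[X [FX [Xv|Hv]]]].
    - by exists X; split=> //; left.
    - by exists X0; split=> //; right.
    - by left; exists X.
    - by right.
  split.
  - by right; case: GH.
  - move=> u v s t /UE[X [FX Xu]] /UE[Y [FY Yv]]; apply/UE.
    have sub Z Z' w r : (Z `<=` Z')%classic -> U Z w r -> U Z' w r.
      by move=> ZZ [/ZZ|]; [left | right].
    case: (Ftot _ _ FX FY) => XY.
      exists Y; split=> //; case: (FG _ FY) => _ + _; apply=> //.
      exact: sub XY Xu.
    exists X; split=> //; case: (FG _ FX) => _ + _; apply=> //.
    exact: sub XY Yv.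
  - by move=> t /UE[X [FX Xt]]; case: (FG _ FX) => _ _; apply.
have GU : graph_hom (U A) by [].
have tot v : exists t, U A v t.
  have [H' [GH' UH' [t Ht]]] := graph_hom_extend v GU.
  exists t; apply: contrapT => nU.
  apply: (Amax (fun p => H' p.1 p.2)).
    split=> [[u s] /= Au|sub]; first by apply: UH'; left.
    by apply: nU; left; apply: (sub (v, t)).
  have -> : U (fun p => H' p.1 p.2) = H'; last by [].
  apply/funext => u; apply/funext => s; apply/propext.
  by split=> [[//|Hu]|Hu]; [apply: UH'; right | left].
have [_ UB U0] := GU.
have fn v s t : U A v s -> U A v t -> s = t.
  move=> Us Ut; apply/eqP; rewrite -subr_eq0; apply/eqP/U0.
  by rewrite -(subrr v); apply: UB.
have [f fE] := choice tot.
have [|chi chiE] := @additive_of V D f.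
  by move=> x y; apply: (fn (x - y)) => //; apply: UB.
by exists chi => v t Hv; rewrite chiE; apply: (fn v) => //; right.
Qed.

(** If n is the order of v modulo U, a nonzero x in D with n x = 0 makes u + k v |-> k x well
    defined on U + Zv; this extends to V. *)
Lemma character_separate (V : zmodType) (U : V -> Prop) v :
  U 0 -> (forall x y, U x -> U y -> U (x - y)) -> ~ U v ->
  exists chi : {additive V -> D}, (forall u, U u -> chi u = 0) /\ chi v <> 0.
Proof.
move=> U0 UB nUv.
have [||n nE] := @int_subgroup (fun k => U (v *~ k)).
- by rewrite mulr0z.
- by move=> k l Uk Ul; rewrite mulrzBr; apply: UB.
have n1 : n != 1%N.
  apply/eqP => n1; apply: nUv; rewrite -[v]mulr1z; apply/nE; exists 1.
  by rewrite n1 mulr1.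
have [x [x0 xn]] := DP.2 _ n1.
have GH : graph_hom (fun w t => exists u k, [/\ U u, w = u + v *~ k & t = x *~ k]).
  split.
  - by exists 0, 0; rewrite !mulr0z addr0.
  - move=> _ _ _ _ [u1 [k1 [U1 -> ->]]] [u2 [k2 [U2 -> ->]]].
    exists (u1 - u2), (k1 - k2); rewrite !mulrzBr opprD addrACA.
    by split=> //; apply: UB.
  - move=> t [u [k [Uu /esym/eqP]]]; rewrite addr_eq0 => /eqP uE ->.
    have /nE[q kE] : U (v *~ (- k)) by rewrite mulrNz -uE.
    have -> : k = n%:Z * - q by rewrite mulrN mulrC -kE opprK.
    by rewrite mulrzA -[x *~ n]/(x *+ n) xn mul0rz.
have [chi chiE] := character_extend GH.
exists chi; split=> [u Uu|].
  by apply: chiE; exists u, 0; rewrite !mulr0z addr0.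
suff -> : chi v = x by apply/eqP.
by apply: chiE; exists 0, 1; rewrite !mulr1z add0r.
Qed.

End Characters.

(** * Character modules and tensor products *)

Section CharacterModule.
Variables (D : zmodType).

(* An action of [S] on the right of [V]; both the left module [Hom(I, D)] of a
   right module [I] and the right module [Hom(R, D)] are instances. *)
Definition right_action (S : pzRingType) (V : zmodType) (act : S -> V -> V) : Prop :=
  [/\ forall s x y, act s (x - y) = act s x - act s y,
      forall s t x, act (s + t) x = act s x + act t x,
      forall x, act 1 x = x &
      forall s t x, act (s * t) x = act t (act s x)].

Section Construction.
Variables (S : pzRingType) (V : zmodType) (act : S -> V -> V).
Hypothesis actP : right_action act.

Definition char_pred of right_action act : {pred V -> D} :=
  fun f => `[< forall x y, f (x - y) = f x - f y >].

Fact char_pred_closed : zmod_closed (char_pred actP).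
Proof.
split=> [|f g /asboolP fA /asboolP gA]; apply/asboolP => x y.
  by rewrite /GRing.zero /= subr0.
rewrite -[LHS]/(f (x - y) - g (x - y)) -[RHS]/(f x - g x - (f y - g y)).
by rewrite fA gA !opprD addrACA.
Qed.

HB.instance Definition _ :=
  GRing.isZmodClosed.Build (V -> D) (char_pred actP) char_pred_closed.

Definition char := {f : V -> D | f \in char_pred actP}.

HB.instance Definition _ := SubType.on char.
HB.instance Definition _ := [Choice of char by <:].
HB.instance Definition _ := [SubChoice_isSubZmodule of char by <:].

Lemma char_additive (f : char) x y : val f (x - y) = val f x - val f y.
Proof. by case: f => f /= /asboolP. Qed.

Lemma char_exists (f : V -> D) :
  (forall x y, f (x - y) = f x - f y) -> exists c : char, val c = f.
Proof. by move=> fA; exists (exist _ f (asboolT fA) : char). Qed.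

Lemma char_ext (f g : char) : (forall x, val f x = val g x) -> f = g.
Proof. by move=> fg; apply: val_inj; apply/funext => x; apply: fg. Qed.

Fact char_scale_subproof s (f : char) :
  (fun x => val f (act s x)) \in char_pred actP.
Proof. by apply/asboolP => x y; have [aB _ _ _] := actP; rewrite aB char_additive. Qed.

Definition char_scale s (f : char) : char :=
  exist (fun g => g \in char_pred actP) _ (char_scale_subproof s f).

Lemma char0 (f : char) : val f 0 = 0.
Proof. by rewrite -[X in val f X](subrr 0) char_additive subrr. Qed.

Lemma charN (f : char) x : val f (- x) = - val f x.
Proof. by rewrite -sub0r char_additive char0 sub0r. Qed.

Lemma charD (f : char) x y : val f (x + y) = val f x + val f y.
Proof. by rewrite -[y in LHS]opprK char_additive charN opprK. Qed.

Fact char_scaleA s t f : char_scale s (char_scale t f) = char_scale (s * t) f.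
Proof. by apply: char_ext => x /=; have [_ _ _ ->] := actP. Qed.
Fact char_scale1 : left_id 1 char_scale.
Proof. by move=> f; apply: char_ext => x /=; have [_ _ -> _] := actP. Qed.
Fact char_scaleDr : right_distributive char_scale +%R.
Proof. by move=> s f g; apply: char_ext => x. Qed.
Fact char_scaleDl f : {morph char_scale^~ f : s t / s + t}.
Proof.
by move=> s t; apply: char_ext => x /=; have [_ -> _ _] := actP; rewrite charD.
Qed.

HB.instance Definition _ := GRing.Zmodule_isLmodule.Build S char
  char_scaleA char_scale1 char_scaleDr char_scaleDl.

Lemma char_scaleE s (f : char) x : val (s *: f) x = val f (act s x).
Proof. by []. Qed.

End Construction.

Variable R : pzRingType.

Fact dual_action (I : lmodType R^c) :
  right_action (fun (r : R) (i : I) => (r : R^c) *: i).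
Proof.
split=> [r x y|r s x|x|r s x].
- exact: scalerBr.
- exact: scalerDl.
- exact: scale1r.
- by rewrite scalerA.
Qed.

Definition dual (I : lmodType R^c) : lmodType R := char (dual_action I).

Fact regular_action : right_action (fun (r : R^c) (x : R) => (r : R) * x).
Proof.
split=> [r x y|r s x|x|r s x].
- exact: mulrBr.
- exact: mulrDl.
- exact: mul1r.
- by rewrite mulrA.
Qed.

Definition regular_dual : lmodType R^c := char regular_action.

Hypothesis DP : cogenerator D.

(** Hom_R(A, Hom(R, D)) is Hom(A, D) through evaluation at 1, so it suffices to extend the character
    a |-> h(a)(1) and to send b to r |-> chi(b r). *)
Lemma regular_dual_injective : injective_mod regular_dual.
Proof.
move=> A B i h iI.
have [|chi chiE] := @character_extend _ DP B
    (fun b t => exists a, i a = b /\ val (h a) 1 = t).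
  split.
  - by exists 0; rewrite !linear0.
  - move=> _ _ _ _ [a [<- <-]] [b [<- <-]]; exists (a - b).
    by rewrite !linearB.
  - by move=> t [a [ia <-]]; have -> : a = 0;
      [apply: iI; rewrite ia linear0 | rewrite linear0].
have kP (b : B) : exists c : regular_dual, forall r, val c r = chi ((r : R^c) *: b).
  have [|c cE] := @char_exists _ _ _ regular_action (fun r => chi ((r : R^c) *: b)).
    by move=> x y; rewrite scalerBl raddfB.
  by exists c => r; rewrite cE.
have [k kE] := choice kP.
have [|k' k'E] := @linear_of R^c B regular_dual k.
  move=> r x y; apply: char_ext => s.
  rewrite kE -[RHS]/(val (k x) ((r : R) * s) + val (k y) s) !kE.
  by rewrite scalerDr raddfD scalerA.
exists k' => a; rewrite k'E; apply: char_ext => r; rewrite kE.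
rewrite -linearZ; have -> : chi (i ((r : R^c) *: a)) = val (h ((r : R^c) *: a)) 1.
  by apply: chiE; exists ((r : R^c) *: a).
by rewrite linearZ /= mulr1.
Qed.

Lemma injective_power (J : Type) (I : lmodType R^c) :
  injective_mod I -> injective_mod (J -> I : lmodType R^c).
Proof.
move=> II A B i h iI.
have hj (j : J) : exists hj : {linear A -> I}, forall a, hj a = h a j.
  by apply: linear_of => r x y; rewrite linearP.
have ext j : exists k : {linear B -> I}, forall a, k (i a) = h a j.
  have [h' h'E] := hj j; have [k kE] := II _ _ i h' iI.
  by exists k => a; rewrite kE h'E.
have [k kE] := choice ext.
have [|k' k'E] := @linear_of R^c B (J -> I : lmodType R^c) (fun b j => k j b).
  by move=> r x y; apply/funext => j; rewrite linearP.
by exists k' => a; rewrite k'E; apply/funext => j; rewrite kE.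
Qed.

Section Tensor.
Variables (I : lmodType R^c).

(** One half of the adjunction between I (x) - and I^+, phrased with balanced maps so that no tensor
    product is chosen; [dual_balanced] is the other half. *)
Lemma balanced_dual (M : lmodType R) (c : I -> M -> D) :
  balanced c -> exists f : {linear M -> dual I}, forall m i, val (f m) i = c i m.
Proof.
move=> [cDl [cDr cZ]].
have c0 m : c 0 m = 0 by apply: (addrI (c 0 m)); rewrite -cDl !addr0.
have cB m x y : c (x - y) m = c x m - c y m.
  by apply: (addIr (c y m)); rewrite -cDl !subrK.
have fP (m : M) : exists f : dual I, forall i, val f i = c i m.
  have [f fE] := char_exists (dual_action I) (cB m).
  by exists f => i; rewrite fE.
have [f fE] := choice fP.
have [|f' f'E] := @linear_of R M (dual I) f.
  move=> r x y; apply: char_ext => i.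
  rewrite fE -[RHS]/(val (f x) ((r : R^c) *: i) + val (f y) i) !fE.
  by rewrite cDr -cZ.
by exists f' => m i; rewrite f'E fE.
Qed.

Lemma dual_balanced (M : lmodType R) (f : {linear M -> dual I}) :
  balanced (fun i m => val (f m) i).
Proof.
split=> [i i' m|]; first by rewrite charD.
by split=> [i m m'|r i m]; [rewrite linearD | rewrite linearZ].
Qed.

(* The tensor product is realised in the functions on the set of balanced maps
   to [D], as the subgroup generated by the evaluations at pairs [(i, m)]. *)
Lemma tensor_exists (M : lmodType R) :
  exists (T : zmodType) (b : I -> M -> T), is_tensor b.
Proof.
pose Bal := {c : I -> M -> D | balanced c}.
pose ev (i : I) (m : M) : Bal -> D := fun c => sval c i m.
pose F := zmodule (Bal -> D).
pose sum (l : seq (I * M)) : F := \sum_(p <- l) ev p.1 p.2.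
have sumE l c : sum l c = \sum_(p <- l) sval c p.1 p.2.
  by rewrite /sum fct_sumE.
have evDl i i' m : ev (i + i') m = ev i m + ev i' m.
  by apply/funext => -[c [cD [? ?]]] /=; apply: cD.
have evDr i m m' : ev i (m + m') = ev i m + ev i m'.
  by apply/funext => -[c [? [cD ?]]] /=; apply: cD.
have evZ (r : R) i m : ev ((r : R^c) *: i) m = ev i (r *: m).
  by apply/funext => -[c [? [? cZ]]] /=; apply: cZ.
have evN i m : ev (- i) m = - ev i m.
  by apply: (addrI (ev i m)); rewrite -evDl !subrr;
    apply: (addrI (ev 0 m)); rewrite -evDl !addr0.
pose negl (l : seq (I * M)) := [seq (- p.1, p.2) | p <- l].
have sum_cat l l' : sum (l ++ l') = sum l + sum l' by rewrite /sum big_cat.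
have sum_neg l : sum (negl l) = - sum l.
  by rewrite /sum big_map -sumrN; apply: eq_bigr => p _; apply: evN.
have hU : @is_submod int F (fun f => exists l, f = sum l).
  split=> [|a _ _ [l ->] [l' ->]]; first by exists [::]; rewrite /sum big_nil.
  have [l1 ->] : exists l1, a *: sum l = sum l1.
    have nat_case n : exists l1, sum l *+ n = sum l1.
      elim: n => [|n [l1 IH]]; first by exists [::]; rewrite /sum big_nil.
      by exists (l1 ++ l); rewrite sum_cat mulrSr IH.
    case: a => n; first exact: nat_case.
    have [l1 e] := nat_case n.+1; exists (negl l1); rewrite sum_neg -e.
    by [].
  by exists (l1 ++ l').
have [T [k [kI kE]]] := submod_exists hU.
have bP (p : I * M) : exists t, k t = ev p.1 p.2.
  by apply/kE; exists [:: p]; rewrite /sum big_seq1.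
have [b bE] := choice bP.
have genP t : exists l, t = \sum_(p <- l) b p.
  have /kE[l lE] : exists x, k x = k t by exists t.
  exists l; apply: kI; rewrite lE raddf_sum /sum.
  by apply: eq_bigr => p _; rewrite -bE.
exists T, (fun i m => b (i, m)); split.
  split=> [i i' m|]; first by apply: kI; rewrite raddfD /= !bE evDl.
  split=> [i m m'|r i m]; first by apply: kI; rewrite raddfD /= !bE evDr.
  by apply: kI; rewrite !bE evZ.
move=> A c cP; split; last first.
  move=> g g' gg' t; have [l ->] := genP t; rewrite !raddf_sum.
  by apply: eq_bigr => -[i m] _; apply: gg'.
pose csum (l : seq (I * M)) := \sum_(p <- l) c p.1 p.2.
have [cDl [cDr cZ]] := cP.
have cN i m : c (- i) m = - c i m.
  by apply: (addrI (c i m)); rewrite -cDl !subrr; apply: (addrI (c 0 m)); rewrite -cDl !addr0.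
have csum_cat l l' : csum (l ++ l') = csum l + csum l' by rewrite /csum big_cat.
have csum_neg l : csum (negl l) = - csum l.
  by rewrite /csum big_map -sumrN; apply: eq_bigr => p _; apply: cN.
(* If the sums in A differed, a character chi would separate them; but chi composed with c is a
   balanced map to D, hence one of the points at which [sum] is evaluated. *)
have wd l l' : sum l = sum l' -> csum l = csum l'.
  move=> e; apply: contrapT => ne.
  have [||chi [_ nz]] := @character_separate _ DP A (fun x => x = 0) (csum l - csum l') erefl.
  - by move=> x y -> ->; rewrite subrr.
  - by move=> /eqP; rewrite subr_eq0 => /eqP.
  have cb : balanced (fun i m => chi (c i m)).
    split=> [i i' m|]; first by rewrite cDl raddfD.
    by split=> [i m m'|r i m]; [rewrite cDr raddfD | rewrite cZ].
  have chiE l1 : chi (csum l1) = sum l1 (exist _ _ cb).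
    by rewrite sumE raddf_sum.
  by apply: nz; rewrite raddfB !chiE e subrr.
have [lof lofE] := choice genP.
have klof t : k t = sum (lof t).
  rewrite {1}(lofE t) raddf_sum /sum.
  by apply: eq_bigr => p _; apply: bE.
have [|g gE] := @additive_of T A (fun t => csum (lof t)).
  move=> x y; rewrite -csum_neg -csum_cat; apply: wd.
  by rewrite sum_cat sum_neg -!klof raddfB.
exists g => i m; rewrite gE -[RHS](_ : csum [:: (i, m)] = _).
  by apply: wd; rewrite -klof bE /sum big_seq1.
by rewrite /csum big_seq1.
Qed.

(** [tensor_acyclic] quantifies over all choices of tensor products; this supplies one, without
    which nothing could be drawn from it. *)
Lemma tensor_complex_exists (C : complex R) :
  exists (T : int -> zmodType) (b : forall n, I -> cobj C n -> T n)
      (delta : forall n, {additive T n -> T (n + 1)%R}),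
    (forall n, is_tensor (b n)) /\
    (forall n i x, delta n (b n i x) = b (n + 1)%R i (cdif C n x)).
Proof.
have [T TE] := choice (fun n => tensor_exists (cobj C n)).
have [b bE] : exists b : forall n, I -> cobj C n -> T n, forall n, is_tensor (b n).
  by exists (fun n => projT1 (cid (TE n))) => m; apply: projT2 (cid (TE m)).
have dP m : exists delta : {additive T m -> T (m + 1)%R},
    forall i x, delta (b m i x) = b (m + 1) i (cdif C m x).
  have [_ /(_ (T (m + 1)) (fun i x => b (m + 1) i (cdif C m x)))] := bE m.
  case=> // ; have [[bDl [bDr bZ]] _] := bE (m + 1).
  split=> [i i' x|]; first exact: bDl.
  by split=> [i x y|r i x]; [rewrite linearD bDr | rewrite linearZ /= bZ].
have [delta deltaE] : exists delta : forall m, {additive T m -> T (m + 1)%R},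
    forall m i x, delta m (b m i x) = b (m + 1) i (cdif C m x).
  by exists (fun m => projT1 (cid (dP m))) => m; apply: projT2 (cid (dP m)).
by exists T, b, delta.
Qed.

(** Otherwise a nonzero character would vanish on all pure tensors, against uniqueness in the
    universal property. *)
Lemma tensor_generated (M : lmodType R) (T : zmodType) (b : I -> M -> T) t :
  is_tensor b -> exists l : seq (I * M), t = \sum_(p <- l) b p.1 p.2.
Proof.
move=> [[bDl [bDr bZ]] uniq]; apply: contrapT => nt.
have bN i m : - b i m = b (- i) m.
  apply: (addrI (b i m)); rewrite -bDl !subrr.
  by apply: (addrI (b 0 m)); rewrite -bDl !addr0.
have [|||chi [chi0 chit]] := @character_separate _ DP T
    (fun t => exists l : seq (I * M), t = \sum_(p <- l) b p.1 p.2) t.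
- by exists [::]; rewrite big_nil.
- move=> _ _ [l ->] [l' ->]; exists (l ++ [seq (- p.1, p.2) | p <- l']).
  rewrite big_cat big_map -sumrN /=; congr (_ + _).
  by apply: eq_bigr => p _; apply: bN.
- by move=> [l tE]; apply: nt; exists l.
apply: chit; have [|_ uq] := uniq D (fun _ _ => 0).
  by split=> [*|]; [rewrite addr0 | split=> [*|*//]; rewrite addr0].
apply: (uq chi (\0 : {additive _ -> _})) => i m /=.
by apply: chi0; exists [:: (i, m)]; rewrite big_seq1.
Qed.

(** A cocycle is a character of I (x) C_(n+1) killing the boundaries, hence the cycles; it induces a
    character on the image of the next differential, which extends because D is injective. *)
Lemma tensor_hom_acyclic (C : complex R) :
  tensor_acyclic I C -> hom_acyclic C (dual I).
Proof.
move=> tC n c cE.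
have [T [b [delta [bE deltaE]]]] := tensor_complex_exists C.
have exT := tC T b delta bE deltaE.
have [_ /(_ D _ (dual_balanced c))[[chi chiE] _]] := bE (n + 1).
have chi0 t : chi (delta n t) = 0.
  have [_ /(_ D (fun _ _ => 0))[|_ uniq]] := bE n.
    by split=> [*|]; [rewrite addr0 | split=> [*|*//]; rewrite addr0].
  apply: (uniq (chi \o delta n : {additive _ -> _}) (\0 : {additive _ -> _})).
  by move=> i x /=; rewrite deltaE chiE cE.
have [|chi' chi'E] := @character_extend _ DP (T (n + 1 + 1))
    (fun t d => exists s, delta (n + 1) s = t /\ chi s = d).
  split.
  - by exists 0; rewrite !raddf0.
  - by move=> _ _ _ _ [s [<- <-]] [t [<- <-]]; exists (s - t); rewrite !raddfB.
  - move=> d [s [s0 <-]]; have [_ /(_ s s0)[t <-]] := exT n; exact: chi0.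
have [|c' c'E] := @balanced_dual (cobj C (n + 1 + 1)) (fun i x => chi' (b _ i x)).
  have [[bDl [bDr bZ]] _] := bE (n + 1 + 1).
  split=> [i i' x|]; first by rewrite bDl raddfD.
  by split=> [i x y|r i x]; [rewrite bDr raddfD | rewrite bZ].
exists c' => x; apply: char_ext => i; rewrite c'E -deltaE -chiE.
by apply/esym/chi'E; exists (b (n + 1) i x).
Qed.

(** A cycle that is no boundary is detected by a character killing boundaries. That character is a
    cocycle, hence factors through the next differential and vanishes on the cycle after all. *)
Lemma hom_tensor_acyclic (C : complex R) :
  acyclic C -> hom_acyclic C (dual I) -> tensor_acyclic I C.
Proof.
move=> acC hC T b delta bE deltaE n.
have dd y : delta (n + 1) (delta n y) = 0.
  have [_ /(_ (T (n + 1 + 1)) (fun _ _ => 0))[|_ uniq]] := bE n.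
    by split=> [*|]; [rewrite addr0 | split=> [*|*//]; rewrite addr0].
  apply: (uniq (delta (n + 1) \o delta n : {additive _ -> _}) (\0 : {additive _ -> _})).
  move=> i x /=; rewrite !deltaE; have [-> _] := acC n.
  have [[_ [bDr _]] _] := bE (n + 1 + 1).
  by apply: (addrI (b (n + 1 + 1) i 0)); rewrite -bDr !addr0.
split=> // t t0; apply: contrapT => nex.
have [|||chi [chi0 chit]] := @character_separate _ DP (T (n + 1))
    (fun t => exists y, delta n y = t) t.
- by exists 0; rewrite raddf0.
- by move=> _ _ [x <-] [y <-]; exists (x - y); rewrite raddfB.
- by [].
have [[bDl [bDr bZ]] uniq] := bE (n + 1).
have cb : balanced (fun i x => chi (b (n + 1) i x)).
  split=> [i i' x|]; first by rewrite bDl raddfD.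
  by split=> [i x y|r i x]; [rewrite bDr raddfD | rewrite bZ].
have [c cE] := balanced_dual cb.
have [|c' c'E] := hC n c.
  by move=> x; apply: char_ext => i; rewrite cE -deltaE chi0 //; exists (b n i x).
have [_ /(_ D _ (dual_balanced c'))[[chi' chi'E] _]] := bE (n + 1 + 1).
apply: chit.
have [_ uq] := uniq D _ cb.
rewrite (uq chi (chi' \o delta (n + 1) : {additive _ -> _})) /= ?t0 ?raddf0 //.
by move=> i x /=; rewrite deltaE chi'E -c'E cE.
Qed.

End Tensor.

Definition is_dual (N : lmodType R) : Prop :=
  exists I : lmodType R^c, injective_mod I /\ N = dual I.

(** Besides the duality, this trades the image in degree [n + 1] for the kernel of the outgoing
    differential. *)
Lemma I_syzygyE (X : lmodType R -> Prop) M :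
  I_syzygy_of X M <-> syzygy X is_dual M.
Proof.
split=> [[C [XC [acC [tC [n [f [fI fE]]]]]]]|[C [XC acC hC [n [f [fI fE]]]]]].
  exists C; split=> //.
    by move=> _ [I [II ->]]; apply/tensor_hom_acyclic/tC.
  exists (n + 1), f; split=> // y; have [dd ex] := acC n; rewrite -fE.
  by split=> [/ex//|[x <-]]; apply: dd.
have [m eqn] := int_succ n; subst n.
exists C; split=> //; split=> //; split.
  by move=> I II; apply: hom_tensor_acyclic => //; apply: hC; exists I.
exists m, f; split=> // y; have [dd ex] := acC m; rewrite -fE.
by split=> [[x <-]|/ex//]; apply: dd.
Qed.

End CharacterModule.

(** * A Mittag-Leffler condition for cochains *)

Section Cochains.
Variables (R : pzRingType) (X : eqType) (B : lmodType R).
Variables (Dl El : X -> seq (R * X)).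
Implicit Types (c w : X -> B) (S T : seq X) (Y Z : X -> Prop).

(** A row-finite matrix acting on functions; each value of the result reads finitely many values of
    [c]. *)
Definition cochain_op (L : X -> seq (R * X)) c : X -> B :=
  fun x => \sum_(p <- L x) p.1 *: c p.2.

Local Notation d := (cochain_op Dl).
Local Notation e := (cochain_op El).

(** In the application [e] replaces a function on the disjoint union of the C_n by its linear
    extension, which has the same differential. *)
Hypothesis dd : forall c x, d (d c) x = 0.
Hypothesis ee : forall c x, e (e c) x = e c x.
Hypothesis de : forall c x, d (e c) x = d c x.
Hypothesis ed : forall c x, e (d c) x = d c x.

Definition supp (L : X -> seq (R * X)) S : seq X :=
  flatten [seq [seq p.2 | p <- L x] | x <- S].

Lemma suppP L S y :
  reflect (exists x p, [/\ x \in S, p \in L x & p.2 = y]) (y \in supp L S).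
Proof.
apply: (iffP flatten_mapP) => [[x xS /mapP[p px ->]]|[x [p [xS px <-]]]].
  by exists x, p.
by exists x => //; apply/mapP; exists p.
Qed.

Lemma cochain_op_local L c c' x :
  (forall y, y \in supp L [:: x] -> c y = c' y) ->
  cochain_op L c x = cochain_op L c' x.
Proof.
move=> cc'; apply: eq_big_seq => p px; rewrite cc' //.
by apply/suppP; exists x, p; rewrite mem_head.
Qed.

Lemma cochain_opB L c c' x :
  cochain_op L (fun y => c y - c' y) x = cochain_op L c x - cochain_op L c' x.
Proof. by rewrite -sumrB; apply: eq_bigr => p _; rewrite scalerBr. Qed.

Lemma cochain_opD L c c' x :
  cochain_op L (fun y => c y + c' y) x = cochain_op L c x + cochain_op L c' x.
Proof. by rewrite -big_split; apply: eq_bigr => p _; rewrite scalerDr. Qed.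

Lemma cochain_op0 L c x :
  (forall y, y \in supp L [:: x] -> c y = 0) -> cochain_op L c x = 0.
Proof.
move=> c0; rewrite (@cochain_op_local L c (fun _ => 0)) //.
by apply: big1 => p _; rewrite scaler0.
Qed.

Definition inside S Y := forall x, x \in S -> Y x.

(** On such a set the values of [d c] and [e c] depend only on those of [c] there, so both operators
    restrict to functions on Y. *)
Definition stable Y := forall x, Y x ->
  inside (supp Dl [:: x]) Y /\ inside (supp El [:: x]) Y.

(* A cochain is an arbitrary function on the indices, of which only the
   projection by the idempotent [e] matters. *)
Definition exact_over S S' := forall c,
  (forall x, x \in S' -> d c x = 0) ->
  exists c', forall x, x \in S -> e c x = d c' x.

Definition good Y := stable Y /\ forall S, inside S Y ->
  exists S', inside S' Y /\ exact_over S S'.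

Lemma inside_cat S T Y : inside (S ++ T) Y <-> inside S Y /\ inside T Y.
Proof.
split=> [H|[HS HT] x]; last by rewrite mem_cat => /orP[/HS|/HT].
by split=> x xS; apply: H; rewrite mem_cat xS ?orbT.
Qed.

Lemma stable_supp L S Y : (L = Dl \/ L = El) -> stable Y -> inside S Y ->
  inside (supp L S) Y.
Proof.
move=> LE stY SY y /suppP[x [p [xS px pE]]].
have [HD HE] := stY x (SY x xS).
have yx : y \in supp L [:: x] by apply/suppP; exists x, p; rewrite mem_head.
by case: LE yx => -> yx; [apply: HD | apply: HE].
Qed.

Lemma supp_sub L S x : x \in S -> {subset supp L [:: x] <= supp L S}.
Proof.
move=> xS y /suppP[x' [p [+ px pE]]]; rewrite inE => /eqP xx'; subst x'.
by apply/suppP; exists x, p.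
Qed.

Definition restrict S Y : seq X := [seq x <- S | `[< Y x >]].

Lemma mem_restrict S Y x : x \in restrict S Y <-> x \in S /\ Y x.
Proof.
rewrite mem_filter; split=> [/andP[/asboolP ? ?]//|[? ?]].
by apply/andP; split=> //; apply/asboolP.
Qed.

Lemma stableI Y Z : stable Y -> stable Z -> stable (fun x => Y x /\ Z x).
Proof.
move=> sY sZ x [Yx Zx]; have [? ?] := sY x Yx; have [? ?] := sZ x Zx.
by split=> y yx; split; auto.
Qed.

(* Mayer-Vietoris: the solutions on [Y] and [Z] differ on the intersection by a
   cocycle, hence by a coboundary, which corrects the solution on [Y]. *)
Lemma good_union Y Z :
  good Y -> good Z -> good (fun x => Y x /\ Z x) -> good (fun x => Y x \/ Z x).
Proof.
move=> [stY gY] [stZ gZ] [stI gI]; split.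
  move=> x [/stY|/stZ] [HD HE]; split=> y yx.
  - by left; apply: HD.
  - by left; apply: HE.
  - by right; apply: HD.
  - by right; apply: HE.
move=> S SYZ.
pose SY := restrict S Y; pose SZ := restrict S Z.
(* The finitely many common indices that [d] reads at points of S; the two solutions must be matched
   only on these. *)
pose T := restrict (supp Dl SY ++ supp Dl SZ) (fun x => Y x /\ Z x).
have [|T' [T'I T'E]] := gI T; first by move=> x /mem_restrict[].
(* Solving on T' as well, on both sides, makes the difference of the solutions a cocycle there. *)
have [|S1 [S1Y S1E]] := gY (SY ++ T').
  by apply/inside_cat; split=> x; [case/mem_restrict | case/T'I].
have [|S2 [S2Z S2E]] := gZ (SZ ++ T').
  by apply/inside_cat; split=> x; [case/mem_restrict | case/T'I].
exists (S1 ++ S2); split.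
  by apply/inside_cat; split=> x; [move/S1Y; left | move/S2Z; right].
move=> c c0.
have [|cY cYE] := S1E c; first by move=> x xS; apply: c0; rewrite mem_cat xS.
have [|cZ cZE] := S2E c; first by move=> x xS; apply: c0; rewrite mem_cat xS orbT.
have [|v vE] := T'E (fun x => cY x - cZ x).
  move=> x xT; rewrite cochain_opB -cYE ?mem_cat ?xT ?orbT //.
  by rewrite -cZE ?mem_cat ?xT ?orbT // subrr.
pose c1 x := e cY x - d v x.
have c1T x : x \in T -> c1 x = e cZ x.
  by move=> xT; rewrite /c1 -vE // cochain_opB opprB addrC subrK.
exists (fun x => if `[< Y x >] then c1 x else e cZ x) => x xS.
case: (pselect (Y x)) => [Yx|nYx].
  have xSY : x \in SY by apply/mem_restrict.
  rewrite cYE ?mem_cat ?xSY // -(de cY) -[LHS]subr0 -(dd v x) -cochain_opB.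
  apply: cochain_op_local => y yx; case: asboolP => // nY.
  by case: nY; case: (stY x Yx) => + _; apply.
have Zx : Z x by case: (SYZ x xS).
have xSZ : x \in SZ by apply/mem_restrict.
rewrite cZE ?mem_cat ?xSZ // -(de cZ).
apply: cochain_op_local => y yx; case: asboolP => // Yy; rewrite c1T //.
apply/mem_restrict; split.
  by rewrite mem_cat (supp_sub xSZ yx) orbT.
by split=> //; case: (stZ x Zx) => + _; apply.
Qed.

(* Cochains vanishing on [Y] are the cochains of the quotient complex. *)
Lemma good_relative Y Z S :
  good Y -> good Z -> (forall x, Y x -> Z x) -> inside S Z ->
  exists S', inside S' Z /\ forall c, (forall x, Y x -> c x = 0) ->
    (forall x, x \in S' -> d c x = 0) ->
    exists c', (forall x, Y x -> c' x = 0) /\ forall x, x \in S -> e c x = d c' x.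
Proof.
move=> [stY gY] [stZ gZ] YZ SZ.
pose T0 := restrict (supp Dl S) Y.
have [|T [TY TE]] := gY T0; first by move=> x /mem_restrict[].
have [|S' [S'Z S'E]] := gZ (S ++ T).
  by apply/inside_cat; split=> // x /TY/YZ.
exists S'; split=> // c cY c0.
have [c1 c1E] := S'E c c0.
have [|v vE] := TE c1.
  move=> x xT; rewrite -c1E ?mem_cat ?xT ?orbT //.
  by apply: cochain_op0 => y yx; apply: cY; case: (stY x (TY x xT)) => _; apply.
(* It vanishes at every point of Y that [d] reads from S, so setting it to 0 on all of Y leaves its
   differential on S unchanged. *)
pose c2 x := e c1 x - d v x.
have c2T x : x \in T0 -> c2 x = 0 by move=> xT; rewrite /c2 vE // subrr.
exists (fun x => if `[< Y x >] then 0 else c2 x); split=> [x Yx|x xS].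
  by case: asboolP.
rewrite c1E ?mem_cat ?xS // -(de c1) -[LHS]subr0 -(dd v x) -cochain_opB.
apply: cochain_op_local => y yx; case: asboolP => // Yy.
by rewrite -/(c2 y) c2T //; apply/mem_restrict; split=> //; apply: supp_sub yx.
Qed.

(* A Mittag-Leffler argument: each correction is made invisible on the part
   of [Z] already treated, so that the partial solutions converge. *)
Lemma good_countable Y Z (g : nat -> X) c :
  good Y -> good Z -> (forall x, Y x -> Z x) ->
  (forall x, Z x <-> exists n, g n = x) ->
  (forall x, Y x -> c x = 0) -> (forall x, d c x = 0) ->
  exists c', (forall x, Y x -> c' x = 0) /\ forall x, Z x -> e c x = d c' x.
Proof.
move=> gY gZ YZ gE cY dc0; have [stY _] := gY; have [stZ _] := gZ.
have rel S : exists S', inside S Z -> inside S' Z /\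
    forall c, (forall x, Y x -> c x = 0) -> (forall x, x \in S' -> d c x = 0) ->
    exists c', (forall x, Y x -> c' x = 0) /\ forall x, x \in S -> e c x = d c' x.
  case: (pselect (inside S Z)) => [SZ|nS]; last by exists [::].
  by have [S' S'P] := good_relative gY gZ YZ SZ; exists S'.
have [rho rhoE] := choice rel.
(* The points [g m] exhaust Z, [rho] makes room for the correction on the previous stage, and
   [supp Dl] ensures that [d] at a point of [S m] reads only [S m.+1]. *)
pose S := fix S n := if n is m.+1 then
  g m :: S m ++ rho (S m) ++ supp Dl (S m) else [::].
have SZ n : inside (S n) Z.
  elim: n => [|n IH] //= x; rewrite inE => /orP[/eqP ->|]; first by apply/gE; exists n.
  move: x; apply/inside_cat; split=> //; apply/inside_cat; split.
    by case: (rhoE _ IH).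
  by apply: stable_supp IH => //; left.
have Sle m n : (m <= n)%N -> {subset S m <= S n}.
  elim: n => [|n IH]; first by rewrite leqn0 => /eqP ->.
  rewrite leq_eqVlt ltnS => /orP[/eqP -> //|/IH sub x /sub xS /=].
  by rewrite inE mem_cat xS orbT.
have eY f x : (forall x, Y x -> f x = 0) -> Y x -> e f x = 0.
  by move=> f0 Yx; apply: cochain_op0 => y yx; apply: f0; case: (stY x Yx) => _; apply.
have dY f x : (forall x, Y x -> f x = 0) -> Y x -> d f x = 0.
  by move=> f0 Yx; apply: cochain_op0 => y yx; apply: f0; case: (stY x Yx) => + _; apply.
(* Solutions run one stage ahead: [S n.+1] contains [rho (S n)], where two solutions must have the
   same differential before their difference can be corrected on [S n]. Invariance under [e] makes
   that difference itself a coboundary there. *)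
pose P n u := [/\ forall x, Y x -> u x = 0, forall x, e u x = u x &
                  forall x, x \in S n.+1 -> e c x = d u x].
have init n : exists u, P n u.
  have [_ /(_ c cY)[//|u [uY uE]]] := rhoE _ (SZ n.+1).
  exists (e u); split=> [x|x|x xS]; [exact: eY | exact: ee | by rewrite de uE].
have step n u : P n u -> exists u', P n.+1 u' /\ forall x, x \in S n -> u' x = u x.
  move=> [uY ue uE]; have [w [wY we wE]] := init n.+1.
  pose dl x := w x - u x.
  have dlY x : Y x -> dl x = 0 by move=> Yx; rewrite /dl wY // uY // subrr.
  have [_ /(_ dl dlY)[|v [vY vE]]] := rhoE _ (SZ n).
    move=> x xS; have xS1 : x \in S n.+1 by rewrite /= inE !mem_cat xS !orbT.
    by rewrite cochain_opB -uE // -wE ?subrr //; apply: Sle xS1.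
  (* On [S n] the difference w - u equals [d v], so the new solution agrees with u there, while d d
     = 0 keeps its differential. *)
  exists (fun x => w x - d v x); split; first split.
  - by move=> x Yx; rewrite wY // dY // subrr.
  - by move=> x; rewrite cochain_opB ed we.
  - by move=> x xS; rewrite cochain_opB dd subr0 wE.
  - by move=> x xS; rewrite -vE // cochain_opB we ue opprB addrC subrK.
have [u0 u0P] := init 0%N.
have [u uP] : exists u : nat -> X -> B, forall n,
    P n (u n) /\ forall x, x \in S n -> u n.+1 x = u n x.
  have [|f fE] := @choice {p | P p.1 p.2} {p | P p.1 p.2} (fun p q =>
      (sval q).1 = (sval p).1.+1 /\
      forall x, x \in S (sval p).1 -> (sval q).2 x = (sval p).2 x).
    move=> [[n u] /= uP]; have [u' [u'P uu']] := step n u uP.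
    by exists (exist _ (n.+1, u') u'P).
  pose s n := iter n f (exist _ (0%N, u0) u0P).
  have s1 n : (sval (s n)).1 = n
    by elim: n => [//|n IH] /=; have [-> _] := fE (s n); rewrite IH.
  exists (fun n => (sval (s n)).2) => n; split.
    by have := svalP (s n); rewrite s1.
  by move=> x xS; have [_ fn] := fE (s n); apply: fn; rewrite s1.
have ule m n x : (m <= n)%N -> x \in S m -> u n x = u m x.
  move=> + xS; elim: n => [|n IH]; first by rewrite leqn0 => /eqP ->.
  rewrite leq_eqVlt ltnS => /orP[/eqP -> //|mn].
  by rewrite (uP n).2 ?IH //; apply: Sle xS.
have lim x : exists t, (forall n, x \in S n -> u n x = t) /\ (Y x -> t = 0).
  case: (pselect (exists n, x \in S n)) => [[m xm]|no]; last first.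
    by exists 0; split=> // n xS; case: no; exists n.
  exists (u m x); split=> [n xn|Yx]; last by have [[-> //]] := uP m.
  by case: (leqP m n) => [mn|/ltnW nm]; [apply: ule | apply/esym/ule].
have [t tE] := choice lim.
exists t; split=> [x Yx|x /gE[n xE]]; first exact: (tE x).2.
have xS : x \in S n.+1 by rewrite /= -xE mem_head.
have [[_ _ uE] _] := uP n.+2; rewrite uE.
  apply: cochain_op_local => y yx; apply: (tE y).1.
  rewrite -[S _]/(g n.+1 :: S n.+1 ++ rho (S n.+1) ++ supp Dl (S n.+1)).
  rewrite in_cons mem_cat [X in _ || (_ || X)]mem_cat.
  by rewrite (supp_sub xS yx) !orbT.
by apply: Sle xS; rewrite ltnS -addn2 leq_addr.
Qed.

(** * Sets closed under a choice of finite witnesses *)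

Variable sigma : seq X -> seq X.
Hypothesis sigmaP : forall S, exact_over S (sigma S).

Definition closed Y := stable Y /\ forall S, inside S Y -> inside (sigma S) Y.

(** A union of closed sets need not be closed: [sigma S] may leave it when S is spread over several
    members. Such unions are stable under unions of chains, as Zorn's lemma requires, and are still
    good. *)
Definition union_closed Y :=
  forall x, Y x -> exists Z, [/\ closed Z, Z x & forall y, Z y -> Y y].

Lemma closed_good Y : closed Y -> good Y.
Proof.
by move=> [stY cY]; split=> // S /cY SY; exists (sigma S); split=> //; apply: sigmaP.
Qed.

Lemma closedI Y Z : closed Y -> closed Z -> closed (fun x => Y x /\ Z x).
Proof.
move=> [sY cY] [sZ cZ]; split; first exact: stableI.
move=> S SYZ x xS; split; [apply: (cY S) | apply: (cZ S)] => // y /SYZ[] //.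
Qed.

(** In the induction, the intersection of the first n sets' union with the last set is again a union
    of n closed sets, so the induction hypothesis covers it too. *)
Lemma finite_union_good n (F : nat -> X -> Prop) :
  (forall i, (i < n)%N -> closed (F i)) -> good (fun x => exists i, (i < n)%N /\ F i x).
Proof.
elim: n F => [|n IH] F FC.
  split=> [x [i []] //|S S0]; exists S; split=> // c _; exists c => x /S0[i []] //.
have -> : (fun x => exists i, (i < n.+1)%N /\ F i x) =
    (fun x => (exists i, (i < n)%N /\ F i x) \/ F n x).
  apply/funext => x; apply/propext; split.
    move=> [i []]; rewrite ltnS leq_eqVlt => /orP[/eqP ->|]; first by right.
    by left; exists i.
  by case=> [[i [/ltnW]]|]; [exists i | exists n].
apply: good_union.
- by apply: IH => i /ltnW; apply: FC.
- by apply: closed_good; apply: FC.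
have FCn i : (i < n)%N -> closed (fun x => F i x /\ F n x).
  by move=> ilt; apply: closedI; apply: FC => //; apply: ltnW.
have := IH _ FCn; congr good; apply/funext => x; apply/propext.
by split=> [[i [? [? ?]]]|[[i [? ?]] ?]]; [split=> //; exists i | exists i].
Qed.

(** A finite S lies in the union of finitely many closed sets, and the witness is found inside that
    union. *)
Lemma union_closed_good Y : union_closed Y -> good Y.
Proof.
move=> uY; split.
  move=> x /uY[Z [[sZ _] Zx ZY]]; have [HD HE] := sZ x Zx.
  by split=> y yx; apply: ZY; [apply: HD | apply: HE].
have cov S : inside S Y -> exists n (F : nat -> X -> Prop),
    (forall i, (i < n)%N -> closed (F i) /\ forall x, F i x -> Y x) /\
    inside S (fun x => exists i, (i < n)%N /\ F i x).
  elim: S => [|x S IH] SY.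
    by exists 0%N, (fun _ _ => False); split.
  have [|n [F [FC SF]]] := IH; first by move=> y yS; apply: SY; rewrite inE yS orbT.
  have [Z [ZC Zx ZY]] := uY x (SY x (mem_head _ _)).
  exists n.+1, (fun i => if i == n then Z else F i); split.
  - by move=> i; rewrite ltnS leq_eqVlt; case: eqP => //= _ /FC.
  - move=> y; rewrite inE => /orP[/eqP ->|/SF[i [ilt Fi]]].
      by exists n; rewrite eqxx.
    by exists i; rewrite ltnW // (ltn_eqF ilt).
move=> S /cov[n [F [FC SF]]].
have [|_ /(_ S SF)[S' [S'F S'E]]] := @finite_union_good n F; first by move=> i /FC[].
by exists S'; split=> // x /S'F[i [/FC[_ FY] /FY]].
Qed.

Lemma union_closedI Y Z : union_closed Y -> closed Z -> union_closed (fun x => Y x /\ Z x).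
Proof.
move=> uY ZC x [/uY[W [WC Wx WY]] Zx].
exists (fun y => W y /\ Z y); split=> //; first exact: closedI.
by move=> y [/WY].
Qed.

Lemma union_closedU Y Z : union_closed Y -> closed Z -> union_closed (fun x => Y x \/ Z x).
Proof.
move=> uY ZC x [/uY[W [WC Wx WY]]|Zx].
  by exists W; split=> // y /WY; left.
by exists Z; split=> // y; right.
Qed.

(* Terms over the finitary operations [sigma] and [supp] enumerate the closure
   of a point. *)
Lemma countable_closed x :
  exists Z (g : nat -> X), [/\ closed Z, Z x & forall y, Z y <-> exists n, g n = y].
Proof.
pose ev := fix ev (t : GenTree.tree nat) : X :=
  match t with
  | GenTree.Leaf _ => x
  | GenTree.Node k l => let s := map ev l in nth x (sigma s ++ supp Dl s ++ supp El s) k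
  end.
pose Z y := exists t, ev t = y.
have ZS S : inside S Z -> exists l, S = map ev l.
  elim: S => [|y S IH] SZ; first by exists [::].
  have [|l ->] := IH; first by move=> z zS; apply: SZ; rewrite inE zS orbT.
  by have [t <-] := SZ y (mem_head _ _); exists (t :: l).
have Zop S : inside S Z -> inside (sigma S ++ supp Dl S ++ supp El S) Z.
  move=> /ZS[l ->] y /(nthP x)[k _ <-].
  by exists (GenTree.Node k l).
(* Trees are countable; a number coding no tree is sent to x. *)
exists Z, (fun n => ev (odflt (GenTree.Leaf 0%N) (unpickle n))); split.
- split.
    move=> y Zy; have [|_] := (inside_cat _ _ _).1 (Zop [:: y] _).
      by move=> z; rewrite inE => /eqP ->.
    by move/inside_cat.
  by move=> S /Zop/inside_cat[].
- by exists (GenTree.Leaf 0%N).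
- move=> y; split=> [[t <-]|[n <-]]; last by eexists.
  by exists (pickle t); rewrite pickleK.
Qed.

(** If a maximal partial solution w on Y misses x, its error [e c - d w] vanishes on Y. On a
    countable closed Z around x the error is solved by a cochain vanishing on Y and Z in common, and
    adding this to w off Y solves the equation on the union. *)
Lemma cochain_exact c : (forall x, d c x = 0) -> exists c', forall x, e c x = d c' x.
Proof.
move=> dc0.
pose St := {p : (X -> Prop) * (X -> B) |
  union_closed p.1 /\ forall x, p.1 x -> e c x = d p.2 x}.
pose le (p q : St) := `[< (forall x, (sval p).1 x -> (sval q).1 x) /\
  forall x, (sval p).1 x -> (sval p).2 x = (sval q).2 x >].
have s0 : St by exists (fun _ => False, c); split.
have [|||[[Y w] YwP] Ymax] := @ZL_preorder St s0 le.
- by move=> p; apply/asboolP.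
- move=> q p r /asboolP[pq pqE] /asboolP[qr qrE]; apply/asboolP; split.
    by move=> x /pq/qr.
  by move=> x px; rewrite pqE // qrE //; apply: pq.
- move=> A Atot.
  pose Y x := exists p, A p /\ (sval p).1 x.
  have wP x : exists t, forall p, A p -> (sval p).1 x -> (sval p).2 x = t.
    case: (pselect (Y x)) => [[p [Ap px]]|no]; last first.
      by exists 0 => p Ap px; case: no; exists p.
    exists ((sval p).2 x) => q Aq qx.
    by case: (Atot p q Ap Aq) => /asboolP[_ pq]; [rewrite pq | apply: pq].
  have [w wE] := choice wP.
  have uY : union_closed Y.
    move=> x [p [Ap px]]; have [up _] := svalP p.
    have [Z [ZC Zx Zp]] := up x px.
    by exists Z; split=> // y /Zp py; exists p.
  have wY x : Y x -> e c x = d w x.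
    move=> [p [Ap px]]; have [up pE] := svalP p.
    rewrite pE //; apply: cochain_op_local => y yx; apply: wE => //.
    have [stp _] := union_closed_good up.
    by have [+ _] := stp x px; apply.
  exists (exist _ (Y, w) (conj uY wY)) => p Ap; apply/asboolP; split=> /= x px.
    by exists p.
  exact: wE.
have [/= uY wE] := YwP; exists w => x; apply: (wE); apply: contrapT => nYx.
have [Z [g [ZC Zx gE]]] := countable_closed x.
have [stY _] := union_closed_good uY.
pose c1 y := e c y - d w y.
have [|||||| c2 [c2Y c2Z]] := @good_countable (fun y => Y y /\ Z y) Z g c1.
- exact/union_closed_good/union_closedI.
- exact: closed_good.
- by move=> y [].
- exact: gE.
- by move=> y [Yy _]; rewrite /c1 wE // subrr.
- by move=> y; rewrite cochain_opB dd subr0 de dc0.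
pose w' y := if `[< Y y >] then w y else w y + c2 y.
have uYZ : union_closed (fun y => Y y \/ Z y) by apply: union_closedU.
have w'E y : Y y \/ Z y -> e c y = d w' y.
  move=> YZy; case: (pselect (Y y)) => [Yy|nYy].
    rewrite wE //; apply: cochain_op_local => z zy; rewrite /w'.
    by case: asboolP => // nYz; case: nYz; have [+ _] := stY y Yy; apply.
  have Zy : Z y by case: YZy.
  have -> : d w' y = d (fun z => w z + c2 z) y.
    apply: cochain_op_local => z zy; rewrite /w'; case: asboolP => // Yz.
    rewrite c2Y ?addr0 //; split=> //.
    by have [[stZ _] _] := (ZC, tt); have [+ _] := stZ y Zy; apply.
  by rewrite cochain_opD -c2Z // cochain_opB ee ed addrC subrK.
pose q : St := exist _ (fun y => Y y \/ Z y, w') (conj uYZ w'E).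
have /Ymax/asboolP[/= YZY _] : le (exist _ (Y, w) YwP) q.
  apply/asboolP; split=> /= y Yy; first by left.
  by rewrite /w'; case: asboolP.
by apply: nYx; apply: YZY; right.
Qed.

End Cochains.

(** * The finite condition from tensor exactness *)

Section DualBasis.
Variable R : pzRingType.

Definition coeff (X : eqType) (l : seq (R * X)) (x : X) : R :=
  \sum_(q <- l) if q.2 == x then q.1 else 0.

Lemma sum_coeff (X : eqType) (l : seq (R * X)) (s : seq X) (B : lmodType R)
    (g : X -> B) :
  uniq s -> {subset [seq q.2 | q <- l] <= s} ->
  \sum_(q <- l) q.1 *: g q.2 = \sum_(x <- s) coeff l x *: g x.
Proof.
move=> us ls; under [RHS]eq_bigr => x _ do rewrite scaler_suml.
rewrite exchange_big /=; apply: eq_big_seq => q ql.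
have qs : q.2 \in s by apply: ls; apply: map_f.
rewrite (bigD1_seq q.2) //= eqxx big1 ?addr0 // => x.
by rewrite eq_sym => /negPf ->; rewrite scale0r.
Qed.

Lemma sum_coeff_eq (X : eqType) (l l' : seq (R * X)) (B : lmodType R) (g : X -> B) :
  coeff l =1 coeff l' ->
  \sum_(q <- l) q.1 *: g q.2 = \sum_(q <- l') q.1 *: g q.2.
Proof.
move=> ll'; pose s := undup ([seq q.2 | q <- l] ++ [seq q.2 | q <- l']).
rewrite (@sum_coeff _ l s) ?undup_uniq // => [|x xl]; last first.
  by rewrite mem_undup mem_cat xl.
rewrite (@sum_coeff _ l' s) ?undup_uniq // => [|x xl]; last first.
  by rewrite mem_undup mem_cat xl orbT.
by apply: eq_bigr => x _; rewrite ll'.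
Qed.

Definition lin_comb (X : Type) (B : lmodType R) (l : seq (R * X)) (g : X -> B) : B :=
  \sum_(q <- l) q.1 *: g q.2.

(** P is a retract of the free module on its own set of elements, realised as the finitely supported
    functions [coeff l]; [E p] lists the terms of a section at p. Any function on P thereby acquires
    a linear counterpart, equal to it if it was linear. *)
Lemma projective_dual_basis (P : lmodType R) : projective_mod P ->
  exists E : P -> seq (R * P), forall (B : lmodType R),
    (forall g : P -> B, exists h : {linear P -> B}, forall p, h p = lin_comb (E p) g) /\
    (forall (h : {linear P -> B}) p, lin_comb (E p) h = h p).
Proof.
move=> Pproj.
pose scl (a : R) (l : seq (R * P)) := [seq (a * q.1, q.2) | q <- l].
have coeff_scl a l x : coeff (scl a l) x = a * coeff l x.
  rewrite /coeff big_map mulr_sumr; apply: eq_bigr => q _ /=.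
  by case: eqP => //; rewrite mulr0.
have coeff_cat l l' x : coeff (l ++ l') x = coeff l x + coeff l' x.
  by rewrite /coeff big_cat.
have hU : @is_submod R (P -> R^o : lmodType R) (fun f => exists l, f = coeff l).
  split=> [|a _ _ [l ->] [l' ->]].
    by exists [::]; apply/funext => x; rewrite /coeff big_nil.
  by exists (scl a l ++ l'); apply/funext => x; rewrite coeff_cat coeff_scl.
have [F [k [kI kE]]] := submod_exists hU.
have lP (f : F) : exists l, k f = coeff l :> (P -> R) by apply/kE; exists f.
have [lof lofE] := choice lP.
have lofP l f (B : lmodType R) (g : P -> B) : k f = coeff l :> (P -> R) ->
    lin_comb (lof f) g = lin_comb l g.
  by rewrite lofE => e; apply: sum_coeff_eq => x; rewrite e.
have comb_lin (B : lmodType R) (g : P -> B) :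
    exists h : {linear F -> B}, forall f, h f = lin_comb (lof f) g.
  apply: linear_of => a f f'.
  rewrite (lofP (scl a (lof f) ++ lof f')).
    rewrite /lin_comb big_cat big_map scaler_sumr; congr (_ + _).
    by apply: eq_bigr => q _; rewrite scalerA.
  apply/funext => x; rewrite linearP coeff_cat coeff_scl.
  by rewrite -[LHS]/(a * k f x + k f' x) !lofE.
have [ev evE] := comb_lin P id.
have [|s sE] := Pproj F P ev idfun.
  move=> p; have [f fE] : exists f, k f = coeff [:: (1, p)] :> (P -> R).
    by apply/kE; exists [:: (1, p)].
  by exists f; rewrite evE (lofP _ _ _ _ fE) /lin_comb big_seq1 scale1r.
exists (fun p => lof (s p)) => B; split=> [g|h p].
  by have [h hE] := comb_lin B g; exists (h \o s) => p; rewrite /= hE.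
have -> : lin_comb (lof (s p)) h = h (ev (s p)).
  by rewrite evE /lin_comb linear_sum; apply: eq_bigr => q _; rewrite linearZ_LR.
by rewrite sE.
Qed.

(** The coordinate at y is the linear counterpart of the indicator function of y. *)
Lemma coordinates (P : lmodType R) (E : P -> seq (R * P)) (y : P) :
  (forall (B : lmodType R),
    (forall g : P -> B, exists h : {linear P -> B}, forall p, h p = lin_comb (E p) g) /\
    (forall (h : {linear P -> B}) p, lin_comb (E p) h = h p)) ->
  exists phi : {linear P -> R^o}, forall p, phi p = coeff (E p) y.
Proof.
move=> /(_ R^o)[/(_ (fun x => if x == y then 1 else 0))[phi phiE] _].
exists phi => p; rewrite phiE; apply: eq_bigr => q _.
by case: eqP => _; rewrite ?scaler0 //; apply: mulr1.
Qed.

End DualBasis.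

Section FiniteCondition.
Variables (D : zmodType) (DP : cogenerator D) (R : pzRingType) (C : complex R).
Hypothesis projC : forall n, projective_mod (cobj C n).
Hypothesis tenC : forall I : lmodType R^c, injective_mod I -> tensor_acyclic I C.

(** Expanding each p_i in a dual basis turns the tensor into the sum over y of (sum_i a_i
    phi_y(p_i)) (x) y, whose first factors vanish by hypothesis. The computation takes place after
    applying a separating character. *)
Lemma tensor_vanish (I : lmodType R^c) (P : lmodType R) (T : zmodType)
    (b : I -> P -> T) k (a : 'I_k -> I) (p : 'I_k -> P) :
  projective_mod P -> is_tensor b ->
  (forall c : {linear P -> R^o}, \sum_i (c (p i) : R^c) *: a i = 0) ->
  \sum_i b (a i) (p i) = 0.
Proof.
move=> Pproj [bb _] cp0; have [bDl [bDr bZ]] := bb.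
have [E EP] := projective_dual_basis Pproj.
apply: contrapT => nz.
have [|chi [_ chinz]] := @character_separate _ DP T (fun t => t = 0) _ erefl _ nz.
  by move=> x y -> ->; rewrite subrr.
have [|f fE] := @balanced_dual D R I P (fun i x => chi (b i x)).
  split=> [i i' x|]; first by rewrite bDl raddfD.
  by split=> [i x y|r i x]; [rewrite bDr raddfD | rewrite bZ].
apply: chinz; rewrite raddf_sum /=.
pose s := undup (flatten [seq [seq q.2 | q <- E (p i)] | i : 'I_k]).
have fs i : f (p i) = \sum_(y <- s) coeff (E (p i)) y *: f y.
  rewrite -[LHS](EP _).2; apply: sum_coeff; rewrite ?undup_uniq // => y yE.
  by rewrite mem_undup; apply/flatten_mapP; exists i => //; rewrite mem_enum.
under eq_bigr => i _.
  rewrite -fE fs.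
  have valE (r : seq P) (F : P -> dual D I) x :
      val (\sum_(y <- r) F y) x = \sum_(y <- r) val (F y) x.
    elim: r => [|y r IH]; first by rewrite !big_nil.
    by rewrite !big_cons -IH.
  rewrite valE.
  under eq_bigr => y _ do rewrite char_scaleE.
  over.
rewrite exchange_big /=; apply: big1 => y _.
have [phi phiE] := coordinates y EP.
have := cp0 phi; move=> /(congr1 (val (f y))); rewrite char0 => e.
have valD (r : seq 'I_k) (F : 'I_k -> I) :
    val (f y) (\sum_(i <- r) F i) = \sum_(i <- r) val (f y) (F i).
  elim: r => [|i r IH]; first by rewrite !big_nil char0.
  by rewrite !big_cons -IH charD.
by rewrite -[RHS]e valD; apply: eq_bigr => i _; rewrite phiE.
Qed.

(* Exactness of the tensored complex at a product of copies of the injective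
   module [Hom(R, D)], one for each finite set [S'] that fails. *)
Lemma finite_condition n (S : seq (cobj C (n + 1)%R)) :
  exists S' : seq (cobj C n), forall c : {linear cobj C (n + 1)%R -> R^o},
    (forall y, y \in S' -> c (cdif C n y) = 0) ->
    exists c' : {linear cobj C (n + 1 + 1)%R -> R^o},
      forall s, s \in S -> c s = c' (cdif C (n + 1)%R s).
Proof.
apply: contrapT => noS'.
pose k := size S; pose s (i : 'I_k) := nth 0 S i.
have cP (S' : seq (cobj C n)) : exists c : {linear cobj C (n + 1)%R -> R^o},
    (forall y, y \in S' -> c (cdif C n y) = 0) /\
    ~ exists c' : {linear cobj C (n + 1 + 1)%R -> R^o},
        (fun i => c (s i)) = (fun i => c' (cdif C (n + 1)%R (s i))).
  apply: contrapT => noc; apply: noS'; exists S' => c c0.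
  apply: contrapT => noc'; apply: noc; exists c; split=> // -[c' c'E].
  apply: noc'; exists c' => x /(nthP 0)[i ilt <-].
  exact: (congr1 (fun f => f (Ordinal ilt)) c'E).
have [c cE] := choice cP.
pose U (v : 'I_k -> R) := exists c' : {linear cobj C (n + 1 + 1)%R -> R^o},
    v = (fun i => c' (cdif C (n + 1)%R (s i))).
(* A failing [c S'] gives a vector in R^k outside the subgroup U of vectors that come from some c'
   d. *)
have chiP S' : exists chi : {additive ('I_k -> R) -> D},
    (forall u, U u -> chi u = 0) /\ chi (fun i => c S' (s i)) <> 0.
  apply: (character_separate DP).
  - by exists (\0 : {linear _ -> _}).
  - move=> _ _ [f ->] [g ->]; have [h hE] := sub_linear f g.
    by exists h; apply/funext => i; rewrite hE.
  - by case: (cE S').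
have [chi chiE] := choice chiP.
pose single (i : 'I_k) (r : R) : 'I_k -> R := fun j => if j == i then r else 0.
have sum_single (v : 'I_k -> R) : \sum_i single i (v i) = v.
  apply/funext => j; rewrite fct_sumE (bigD1 j) //= /single eqxx big1 ?addr0 //.
  by move=> i; rewrite eq_sym => /negPf ->.
have aP i S' : exists a : regular_dual D R, forall r, val a r = chi S' (single i r).
  have [|a aE] := @char_exists D _ _ _ (regular_action R) (fun r => chi S' (single i r)).
    move=> x y; rewrite -raddfB; congr (chi S' _); apply/funext => j.
    by rewrite -[RHS]/(single i x j - single i y j) /single; case: eqP => // _; rewrite subr0.
  by exists a => r; rewrite aE.
(* The i-th components of all the characters form one element of the product; the test tensor is the
   sum of the a_i (x) s_i. *)
pose a i S' := projT1 (cid (aP i S')).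
have aE i S' r : val (a i S') r = chi S' (single i r) by apply: (projT2 (cid (aP i S'))).
pose I : lmodType R^c := seq (cobj C n) -> regular_dual D R.
have II : injective_mod I by apply: injective_power; apply: regular_dual_injective.
have sumI (x : 'I_k -> R) S' r :
    val ((\sum_i (x i : R^c) *: (a i : I)) S') r = chi S' (fun i => x i * r).
  rewrite -(sum_single (fun i => x i * r)) raddf_sum fct_sumE.
  elim: (index_enum _) => [|i l IH]; first by rewrite !big_nil.
  by rewrite !big_cons -IH -aE.
have [T [b [delta [bE deltaE]]]] := tensor_complex_exists DP I C.
have exT := tenC II bE deltaE.
(* Contracting with any c' evaluates [chi S'] at vectors c'(d s_i) r; these lie in U because p |->
   c'(p) r is again linear. *)
have t0 : delta (n + 1)%R (\sum_i b (n + 1)%R (a i : I) (s i)) = 0.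
  rewrite raddf_sum /=; under eq_bigr => i _ do rewrite deltaE.
  apply: (@tensor_vanish I _ _ _ k (fun i => a i : I)
    (fun i => cdif C (n + 1)%R (s i)) (@projC _) (bE _)) => c'.
  apply/funext => S'; apply: char_ext => r.
  rewrite (sumI (fun i => c' (cdif C (n + 1)%R (s i)))).
  have [chi0 _] := chiE S'; apply: chi0.
  have [|c'r c'rE] := @linear_of R (cobj C (n + 1 + 1)%R) R^o (fun p => (c' p : R) * r).
    by move=> x p q; rewrite linearP mulrDl -[RHS]/(x * (c' p * r) + c' q * r) mulrA.
  by exists c'r; apply/funext => i; rewrite c'rE.
have [_ /(_ _ t0)[u uE]] := exT n.
have [l lE] := tensor_generated DP u (bE n).
(* The second factors of a preimage u of the test tensor: the finite set whose failure is
   contradicted. *)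
pose S' := [seq q.2 | q <- l].
have [c0 _] := cE S'; have [_ nz] := chiE S'.
(* Contraction with [c S'] kills [delta u], as [c S'] vanishes on d S'. On the test tensor its
   component at S', taken at 1, is the nonzero value of [chi S']. *)
have [_ /(_ I (fun i p => ((c S' p : R) : R^c) *: i))[|[kap kapE] _]] := bE (n + 1)%R.
  split=> [i i' p|]; first exact: scalerDr.
  split=> [i p p'|r i p]; first by rewrite linearD scalerDl.
  by rewrite linearZ scalerA.
apply: nz; have := congr1 kap uE; rewrite lE !raddf_sum /=.
rewrite big1_seq => [|q /andP[_ ql]]; last first.
  rewrite deltaE kapE c0 ?scale0r //.
  by apply: map_f.
move=> /(congr1 (fun f : I => val (f S') 1)) /esym.
under eq_bigr => i _ do rewrite kapE.
rewrite (sumI (fun i => c S' (s i))) => e.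
rewrite -[RHS]e; congr (chi S' _); apply/funext => i; exact/esym/mulr1.
Qed.

End FiniteCondition.

(** * Homomorphisms into projective modules *)

Section ProjectiveTarget.
Variables (R : pzRingType) (C : complex R).
Hypothesis projC : forall n, projective_mod (cobj C n).
Hypothesis acC : acyclic C.
Hypothesis finC : forall n (S : seq (cobj C (n + 1)%R)),
  exists S' : seq (cobj C n), forall c : {linear cobj C (n + 1)%R -> R^o},
    (forall y, y \in S' -> c (cdif C n y) = 0) ->
    exists c' : {linear cobj C (n + 1 + 1)%R -> R^o},
      forall s, s \in S -> c s = c' (cdif C (n + 1)%R s).

(** Data for the differentials are indexed by [n + 1]; every integer has this form, up to a
    transport that uniqueness of equality proofs removes. *)
Lemma shift_family (T : int -> Type) (f : forall n, T (n + 1)%R) :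
  exists g : forall m, T m, forall n, g (n + 1) = f n.
Proof.
exists (fun m => ecast m (T m) (subrK 1 m) (f (m - 1))) => n.
move: (subrK 1 (n + 1)); move: (n + 1 - 1) (addrK 1 n) => m mn; subst m.
by move=> e; rewrite eq_axiomK.
Qed.

Lemma complex_bases : exists E : forall n, cobj C n -> seq (R * cobj C n),
  forall n (B : lmodType R),
    (forall g : cobj C n -> B,
       exists h : {linear cobj C n -> B}, forall p, h p = lin_comb (E n p) g) /\
    (forall (h : {linear cobj C n -> B}) p, lin_comb (E n p) h = h p).
Proof.
pose H n := cid (projective_dual_basis (@projC n)).
by exists (fun n => projT1 (H n)) => n; apply: (projT2 (H n)).
Qed.

Definition total := {n : int & cobj C n}.

Lemma fiber (S : seq total) n :
  exists Sn : seq (cobj C n), forall p, p \in Sn = (Tagged (fun n => cobj C n) p \in S).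
Proof.
elim: S => [|[m p] S [Sn SnE]]; first by exists [::].
have [e|ne] := eqVneq m n; last first.
  exists Sn => q; rewrite inE SnE -tag_eqE /tag_eq /=.
  by rewrite eq_sym (negPf ne).
subst m; exists (p :: Sn) => q; rewrite !inE SnE; congr (_ || _).
by rewrite eq_Tagged.
Qed.

Variable E : forall n, cobj C n -> seq (R * cobj C n).
Hypothesis EP : forall n (B : lmodType R),
    (forall g : cobj C n -> B,
       exists h : {linear cobj C n -> B}, forall p, h p = lin_comb (E p) g) /\
    (forall (h : {linear cobj C n -> B}) p, lin_comb (E p) h = h p).

Definition inj_total n (p : cobj C n) : total := Tagged (fun n => cobj C n) p.

(* Expanding [p] in a dual basis of its module makes [cochain_op El c] the linear
   extension of the values of [c], so that it is [c] itself for linear [c]. *)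
Definition El (x : total) : seq (R * total) :=
  [seq (q.1, inj_total q.2) | q <- E (tagged x)].
Definition Dl (x : total) : seq (R * total) :=
  [seq (q.1, inj_total q.2) | q <- E (cdif C (tag x) (tagged x))].

Section Target.
Variable B : lmodType R.
Implicit Type c : total -> B.

Lemma cochain_linear c n : exists h : {linear cobj C n -> B},
  (forall p, cochain_op El c (inj_total p) = h p).
Proof.
have [h hE] := (EP n B).1 (fun p => c (inj_total p)).
by exists h => p; rewrite hE /cochain_op big_map.
Qed.

(** The identities required of the two operators all rest on this: [d] is [e] followed by
    composition with the differential. *)
Lemma cochain_op_diff c n (p : cobj C n) :
  cochain_op Dl c (inj_total p) = cochain_op El c (inj_total (cdif C n p)).
Proof. by rewrite /cochain_op !big_map. Qed.

Lemma cochain_op_linear c n (h : {linear cobj C n -> B}) p :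
  (forall q, c (inj_total q) = h q) -> cochain_op El c (inj_total p) = h p.
Proof.
move=> ch; rewrite /cochain_op big_map -[RHS](EP n B).2.
by apply: eq_bigr => q _; rewrite /= ch.
Qed.

Lemma cochain_ee c x : cochain_op El (cochain_op El c) x = cochain_op El c x.
Proof.
case: x => n p; have [h hE] := cochain_linear c n.
by rewrite (@cochain_op_linear _ _ h) // hE.
Qed.

Lemma cochain_de c x : cochain_op Dl (cochain_op El c) x = cochain_op Dl c x.
Proof. by case: x => n p; rewrite !cochain_op_diff cochain_ee. Qed.

Lemma cochain_diff_linear c n (h : {linear cobj C (n + 1)%R -> B}) p :
  (forall q, cochain_op El c (inj_total q) = h q) ->
  cochain_op Dl c (inj_total p) = h (cdif C n p).
Proof. by rewrite cochain_op_diff. Qed.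

Lemma cochain_ed c x : cochain_op El (cochain_op Dl c) x = cochain_op Dl c x.
Proof.
case: x => n p; have [h hE] := cochain_linear c (n + 1).
rewrite (@cochain_op_linear _ _ (h \o cdif C n)) => [|q].
  by rewrite (cochain_diff_linear _ hE).
exact: cochain_diff_linear.
Qed.

Lemma cochain_dd c x : cochain_op Dl (cochain_op Dl c) x = 0.
Proof.
case: x => n p; rewrite cochain_op_diff cochain_ed cochain_op_diff.
have [-> _] := acC n; have [h hE] := cochain_linear c (n + 1 + 1).
by rewrite hE linear0.
Qed.

End Target.

(** The condition is applied degree by degree: a finite S meets finitely many degrees, so finitely
    many witnesses are collected, while the solutions c' from all degrees assemble into one
    function. *)
Lemma exact_over_ring (S : seq total) :
  exists S', @exact_over R total R^o Dl El S S'.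
Proof.
have [Sn SnE] : exists Sn : forall n, seq (cobj C (n + 1)%R),
    forall n p, p \in Sn n = (inj_total p \in S).
  exists (fun n => projT1 (cid (fiber S (n + 1)))) => n; exact: (projT2 (cid (fiber S (n + 1)))).
have [S' S'E] : exists S' : forall n, seq (cobj C n), forall n,
    forall c : {linear cobj C (n + 1)%R -> R^o},
    (forall y, y \in S' n -> c (cdif C n y) = 0) ->
    exists c' : {linear cobj C (n + 1 + 1)%R -> R^o},
      forall s, s \in Sn n -> c s = c' (cdif C (n + 1)%R s).
  by exists (fun n => projT1 (cid (finC (Sn n)))) => n; exact: (projT2 (cid (finC (Sn n)))).
(* Points of S in degree n + 1 have their witnesses in degree n, hence [tag x - 1]. *)
exists (flatten [seq [seq inj_total y | y <- S' (tag x - 1)] | x <- S]) => c c0.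
have c'P n : exists c' : {linear cobj C (n + 1 + 1)%R -> R^o},
    forall s, s \in Sn n -> cochain_op El c (inj_total s) = c' (cdif C (n + 1)%R s).
  case: (pselect (exists s, s \in Sn n)) => [[s sS]|no]; last first.
    by exists (\0 : {linear _ -> _}) => s sS; case: no; exists s.
  have [h hE] := cochain_linear c (n + 1).
  have [|c' c'E] := S'E n h.
    move=> y yS; rewrite -(cochain_diff_linear _ hE); apply: c0.
    apply/flatten_mapP; exists (inj_total s); first by rewrite -SnE.
    by rewrite /= addrK; apply: map_f.
  by exists c' => t tS; rewrite hE c'E.
pose c' n := projT1 (cid (c'P n)).
have c'E n s : s \in Sn n -> cochain_op El c (inj_total s) = c' n (cdif C (n + 1)%R s).
  exact: (projT2 (cid (c'P n))).
(* The map [c' n] lives in degree n + 1 + 1, so two shifts index the family by its own degree. *)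
have [g gE] := @shift_family (fun m => {linear cobj C (m + 1)%R -> R^o}) c'.
have [h hE] := @shift_family (fun m => {linear cobj C m -> R^o}) g.
exists (fun x => h (tag x) (tagged x)) => -[m p] xS.
have [n eqm] := int_succ m; subst m.
rewrite (@cochain_diff_linear _ _ _ (c' n)) => [|q]; first by apply: c'E; rewrite SnE.
by rewrite (@cochain_op_linear _ _ _ (h (n + 1 + 1))) // hE gE.
Qed.

(** Each coordinate of c is an R-valued cochain satisfying the same conditions on S'. The values of
    [e c] on S involve finitely many coordinates, whose solutions are summed. *)
Lemma exact_over_projective (B : lmodType R) (S S' : seq total) :
  projective_mod B -> @exact_over R total R^o Dl El S S' -> @exact_over R total B Dl El S S'.
Proof.
move=> Bproj SS' c c0.
have [F FP] := projective_dual_basis Bproj.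
have [phi phiE] := choice (fun y => coordinates y FP).
have phi_op L y (f : total -> B) x :
    phi y (cochain_op L f x) = cochain_op L (fun x => phi y (f x) : R^o) x.
  by rewrite /cochain_op linear_sum; apply: eq_bigr => q _; rewrite linearZ_LR.
have c'P y : exists c' : total -> R^o, forall x, x \in S ->
    cochain_op El (fun x => phi y (c x) : R^o) x = cochain_op Dl c' x.
  by apply: SS' => x xS; rewrite -phi_op c0 // linear0.
have [c' c'E] := choice c'P.
pose s := undup (flatten [seq [seq q.2 | q <- F (cochain_op El c x)] | x <- S]).
exists (fun x => \sum_(y <- s) (c' y x : R) *: y) => x xS.
have -> : cochain_op El c x = \sum_(y <- s) (phi y (cochain_op El c x) : R) *: y.
  transitivity (lin_comb (F (cochain_op El c x)) (idfun : {linear B -> B})).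
    exact: esym ((FP B).2 idfun _).
  rewrite /lin_comb (@sum_coeff _ _ _ s) ?undup_uniq // => [|y yF].
    by apply: eq_bigr => y _; rewrite phiE.
  by rewrite mem_undup; apply/flatten_mapP; exists x.
under eq_bigr => y _ do rewrite phi_op c'E //.
rewrite /cochain_op; under eq_bigr => y _ do rewrite scaler_suml.
rewrite exchange_big; apply: eq_bigr => q _ /=.
by rewrite scaler_sumr; apply: eq_bigr => y _; rewrite scalerA.
Qed.

Lemma hom_acyclic_of_bases (B : lmodType R) : projective_mod B -> hom_acyclic C B.
Proof.
move=> Bproj n c c0.
have [sigma sigmaE] := choice exact_over_ring.
(* Cochains live in all degrees at once; extended by zero outside degree n + 1, [c] remains a
   cocycle. *)
pose f m : {linear cobj C m -> B} :=
  dfwith (fun m => \0 : {linear cobj C m -> B}) c m.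
pose ct (x : total) : B := f (tag x) (tagged x).
have ctE m p : cochain_op El ct (@inj_total m p) = f m p.
  exact: (@cochain_op_linear _ ct m (f m)).
have [||c' c'E] := @cochain_exact R total B Dl El (@cochain_dd B) (@cochain_ee B)
    (@cochain_de B) (@cochain_ed B) sigma _ ct.
- by move=> S; apply: exact_over_projective.
- move=> [m p]; rewrite (@cochain_diff_linear _ _ _ (f (m + 1))) => [|q]; last exact: ctE.
  have [e|ne] := eqVneq m n; last first.
    by rewrite /f dfwith_out // (inj_eq (addIr 1)) eq_sym.
  by subst m; rewrite /f dfwith_in c0.
have [h hE] := cochain_linear c' (n + 1 + 1).
exists h => x; rewrite -(cochain_diff_linear _ hE) -c'E ctE.
by rewrite /f dfwith_in.
Qed.

End ProjectiveTarget.

Lemma projective_hom_acyclic (D : zmodType) (R : pzRingType) (C : complex R)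
    (B : lmodType R) :
  cogenerator D -> (forall n, projective_mod (cobj C n)) -> acyclic C ->
  (forall N, is_dual D N -> hom_acyclic C N) ->
  projective_mod B -> hom_acyclic C B.
Proof.
move=> DP projC acC hC.
have tenC I : injective_mod I -> tensor_acyclic I C.
  by move=> II; apply: (hom_tensor_acyclic DP acC); apply: hC; exists I.
have [E EP] := complex_bases projC.
exact: hom_acyclic_of_bases acC (@finite_condition _ DP _ _ projC tenC) _ EP _.
Qed.

(** The same complex exhibits M as a syzygy for the class of test modules consisting of P alone, to
    which [GP_orth] applies. *)
Lemma syzygy_orth_projective (D : zmodType) (R : pzRingType) (M P : lmodType R) :
  cogenerator D -> syzygy (@projective_mod R) (@is_dual D R) M ->
  projective_mod P -> orth M P.
Proof.
move=> DP [C [projC acC hC MC]] Pproj.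
apply: (@GP_orth R (fun N => N = P)) => //; exists C; split=> // _ ->.
exact: projective_hom_acyclic DP projC acC hC Pproj.
Qed.

Theorem theorem5p7 (R : pzRingType) (M : lmodType R) : PGF M <-> PGF2_I M.
Proof.
have [D DP] := cogenerator_exists.
have PGFE : @PGF R = syzygy (@projective_mod R) (@is_dual D R).
  by apply/funext => N; apply/propext; apply: I_syzygyE.
rewrite /PGF2_I (I_syzygyE DP) PGFE; apply: iff_sym; apply: GP2_stable.
by move=> N P; apply: syzygy_orth_projective.
Qed.
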